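(* Let $\pi$ be a plane in Euclidean space $\mathbb{R}^3$ and $\Sigma$ a circle in $\pi$. Fix a sphere $\gamma$ containing $\Sigma$, and let $\mathcal{M}(\gamma,\pi)$ be the set of spheres tangent both to $\gamma$ and to $\pi$. If $\alpha$ and $\beta$ are spheres belonging to different classes of $\mathcal{M}(\gamma,\pi)$, and $\mathcal{K}$ is the cone circumscribed about $\alpha$ and $\beta$ whose vertex does not lie on $\pi$, then the conic $\sigma=\mathcal{K}\cap\pi$ forms a Poncelet 3-pair with $\Sigma$; that is, there exists a triangle inscribed in $\Sigma$ and circumscribed about $\sigma$.
   Context: The setting is the complexified projective completion of Euclidean 3-space: the given $\pi,\Sigma,\gamma,\alpha,\beta$ are real, but the cone $\mathcal K$, the conic $\sigma$ and the triangle are allowed to be imaginary (complex). Classes of $\mathcal{M}(\gamma,\pi)$: let $S_1,S_2$ be the two points of $\gamma$ at which the tangent plane to $\gamma$ is parallel to $\pi$ (they are the centres of the two inversions interchanging $\gamma$ and $\pi$). For every sphere in $\mathcal{M}(\gamma,\pi)$, the line joining its point of tangency with $\gamma$ to its point of tangency with $\pi$ passes through $S_1$ or through $S_2$; the set $\mathcal M(\gamma,\pi)$ thus splits into two classes, one for which these lines pass through $S_1$ and the other for which they pass through $S_2$. A cone circumscribed about $\alpha$ and $\beta$ is the quadratic cone of all lines through a centre of similitude (homothety centre) of $\alpha$ and $\beta$ that are tangent to $\alpha$ (equivalently, to $\beta$). Of the two centres of similitude of $\alpha$ and $\beta$, one lies on the common tangent plane $\pi$; $\mathcal{K}$ is the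 cone with vertex at the other one. A circle $\Sigma$ and a conic $\sigma$ in one plane form a Poncelet 3-pair $(\Sigma,\sigma)$ if there is a triangle whose vertices lie on $\Sigma$ and whose side lines are tangent to $\sigma$. *)

(* Defs.v *)
From HB Require Import structures.
From mathcomp Require Import all_boot all_order all_algebra.
From mathcomp Require Import classical_sets reals complex.

Set Implicit Arguments.
Unset Strict Implicit.
Unset Printing Implicit Defensive.

Import Order.TTheory GRing.Theory Num.Theory.

Local Open Scope classical_set_scope.
Local Open Scope ring_scope.
Local Open Scope complex_scope.

(* The bilinear (not Hermitian) form, over any field: the complexified spheres
   and circles below are the zero loci of the real equations over [R[i]]. *)
Definition dot (F : fieldType) (u v : 'rV[F]_3) : F := (u *m v^T) 0 0.

(** * Real figures *)

Record plane (R : realType) := Plane {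
  normal : 'rV[R]_3;
  offset : R;
  normal_neq0 : normal != 0 }.

Record sphere (R : realType) := Sphere {
  center : 'rV[R]_3;
  radius : R;
  radius_gt0 : 0 < radius }.

Definition plane_set (R : realType) (pi : plane R) : set 'rV[R]_3 :=
  [set x | dot (normal pi) x = offset pi].

Definition sphere_set (R : realType) (s : sphere R) : set 'rV[R]_3 :=
  [set x | dot (x - center s) (x - center s) = radius s ^+ 2].

Record circle (R : realType) (pi : plane R) := Circle {
  ccenter : 'rV[R]_3;
  cradius : R;
  ccenter_in_plane : plane_set pi ccenter;
  cradius_gt0 : 0 < cradius }.

Definition circle_set (R : realType) (pi : plane R) (c : circle pi) :
    set 'rV[R]_3 :=
  [set x | plane_set pi x /\
    dot (x - ccenter c) (x - ccenter c) = cradius c ^+ 2].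

(* Meaningful for [p] on [s]. *)
Definition tangent_plane (R : realType) (s : sphere R) (p : 'rV[R]_3) :
    set 'rV[R]_3 :=
  [set x | dot (p - center s) (x - p) = 0].

Definition parallel (R : realType) (P Q : set 'rV[R]_3) : Prop :=
  P = Q \/ P `&` Q = set0.

Definition tangent_to_plane_at (R : realType) (s : sphere R) (pi : plane R)
    (p : 'rV[R]_3) : Prop :=
  sphere_set s p /\ tangent_plane s p = plane_set pi.

Definition tangent_spheres_at (R : realType) (s t : sphere R)
    (p : 'rV[R]_3) : Prop :=
  [/\ sphere_set s p, sphere_set t p & tangent_plane s p = tangent_plane t p].

Definition tangent_family (R : realType) (gamma : sphere R) (pi : plane R) :
    set (sphere R) :=
  [set s | (exists p, tangent_spheres_at s gamma p) /\
           (exists q, tangent_to_plane_at s pi q)].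

Definition pole (R : realType) (gamma : sphere R) (pi : plane R)
    (S : 'rV[R]_3) : Prop :=
  sphere_set gamma S /\ parallel (tangent_plane gamma S) (plane_set pi).

(* The class attached to a pole [S]: the line joining the points of tangency
   [p] and [q] passes through [S].  The condition [p != S] only matters for the
   two spheres centred on the axis of [gamma] orthogonal to [pi]: there [p] is
   one of the poles and [pq] is the axis, which carries both poles.  Such a
   sphere is attached to the pole other than [p], as befits the inversion with
   centre [S] exchanging [gamma] and [pi], which must exchange [p] and [q];
   this makes the two classes disjoint. *)
Definition tangent_class (R : realType) (gamma : sphere R) (pi : plane R)
    (S : 'rV[R]_3) : set (sphere R) :=
  [set s | tangent_family gamma pi s /\
    exists p q, [/\ tangent_spheres_at s gamma p, tangent_to_plane_at s pi q,
      p != S & exists k : R, S = p + k *: (q - p)]].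

(** * Complexified projective space *)

(* A point of P^3(C) is a nonzero row of homogeneous coordinates (x, w) with
   x : 'rV_3 and w : 'rV_1, up to proportionality; a line is the row space of a
   2 x 4 matrix of rank 2.  Point sets are sets of homogeneous rows, closed
   under nonzero scaling. *)

Definition hpart (R : realType) (X : 'rV[R[i]]_(3 + 1)) : 'rV[R[i]]_3 :=
  lsubmx X.

Definition hweight (R : realType) (X : 'rV[R[i]]_(3 + 1)) : R[i] :=
  rsubmx X 0 0.

Definition toC (R : realType) (u : 'rV[R]_3) : 'rV[R[i]]_3 :=
  map_mx (real_complex R) u.

Definition same_point (R : realType) (X Y : 'rV[R[i]]_(3 + 1)) : Prop :=
  X != 0 /\ (X == Y)%MS.

Definition finite_point (R : realType) (p : 'rV[R]_3) : 'rV[R[i]]_(3 + 1) :=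
  row_mx (toC p) 1%:M.

Definition point_at_infinity (R : realType) (t : 'rV[R]_3) :
    'rV[R[i]]_(3 + 1) :=
  row_mx (toC t) 0.

Definition line (R : realType) (X Y : 'rV[R[i]]_(3 + 1)) :
    'M[R[i]]_(2, 3 + 1) :=
  col_mx X Y.

Definition planeC (R : realType) (pi : plane R) : set 'rV[R[i]]_(3 + 1) :=
  [set X | X != 0 /\ dot (toC (normal pi)) (hpart X)
                     = (offset pi)%:C * hweight X].

(* Polarization of the homogenized equation |x - w c|^2 = r^2 w^2. *)
Definition polar_form (R : realType) (c : 'rV[R]_3) (r : R)
    (X Y : 'rV[R[i]]_(3 + 1)) : R[i] :=
  dot (hpart X - hweight X *: toC c) (hpart Y - hweight Y *: toC c)
  - (r ^+ 2)%:C * (hweight X * hweight Y).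

Definition circleC (R : realType) (pi : plane R) (c : circle pi) :
    set 'rV[R[i]]_(3 + 1) :=
  [set X | planeC pi X /\ polar_form (ccenter c) (cradius c) X X = 0].

(* [V] is the centre of a homothety carrying [s] onto [t]; a translation is a
   homothety whose centre is at infinity (this occurs for equal radii). *)
Definition similitude_centre (R : realType) (s t : sphere R)
    (V : 'rV[R[i]]_(3 + 1)) : Prop :=
  (exists (p : 'rV[R]_3) (k : R), [/\ same_point V (finite_point p), k != 0 &
     [set p + k *: (x - p) | x in sphere_set s] = sphere_set t]) \/
  (exists u : 'rV[R]_3, [/\ same_point V (point_at_infinity u), u != 0 &
     [set x + u | x in sphere_set s] = sphere_set t]).

(* The line lies in the tangent plane at one of its points [P]; as [P] is
   itself on [L], the vanishing condition puts [P] on the sphere. *)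
Definition tangent_line_sphere (R : realType) (s : sphere R)
    (L : 'M[R[i]]_(2, 3 + 1)) : Prop :=
  exists P : 'rV[R[i]]_(3 + 1), [/\ P != 0, (P <= L)%MS &
    forall Y : 'rV[R[i]]_(3 + 1), (Y <= L)%MS ->
      polar_form (center s) (radius s) P Y = 0].

Definition circumscribed_cone (R : realType) (s : sphere R)
    (V : 'rV[R[i]]_(3 + 1)) : set 'rV[R[i]]_(3 + 1) :=
  [set X | X != 0 /\ exists L : 'M[R[i]]_(2, 3 + 1),
    [/\ row_free L, (V <= L)%MS, (X <= L)%MS & tangent_line_sphere s L]].

(* Over an algebraically closed field a line is tangent to a conic iff it
   meets it in exactly one point. *)
Definition tangent_line_conic (R : realType) (sigma : set 'rV[R[i]]_(3 + 1))
    (L : 'M[R[i]]_(2, 3 + 1)) : Prop :=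
  exists P : 'rV[R[i]]_(3 + 1), [/\ (P <= L)%MS, sigma P &
    forall Y : 'rV[R[i]]_(3 + 1), (Y <= L)%MS -> sigma Y -> same_point P Y].

(* [row_free] says that the three vertices are not collinear. *)
Definition poncelet_3pair (R : realType) (Sigma sigma : set 'rV[R[i]]_(3 + 1)) :
    Prop :=
  exists A B D : 'rV[R[i]]_(3 + 1),
    [/\ row_free (col_mx A (col_mx B D)),
        [/\ Sigma A, Sigma B & Sigma D] &
        [/\ tangent_line_conic sigma (line A B),
            tangent_line_conic sigma (line B D) &
            tangent_line_conic sigma (line D A)]].

(* Main.v *)
Require Import Defs.
From mathcomp Require Import all_boot all_order all_algebra.
From mathcomp Require Import classical_sets reals complex.
From mathcomp Require Import ring lra.

Set Implicit Arguments.
Unset Strict Implicit.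
Unset Printing Implicit Defensive.

Import Order.TTheory GRing.Theory Num.Theory.

Local Open Scope classical_set_scope.
Local Open Scope ring_scope.

(** Let [pi] be the plane [z = 0] and [Sigma] the circle of radius 1 about the
origin, and let [m], [n] be the heights of the poles [S1], [S2] of [gamma], so
that [m n = -1].  If [alpha] and [beta] touch [pi] at [a], [b] and have centres
of signed heights [c], [d], tangency to [gamma] in the classes of [S1], [S2]
reads [|a|^2 = 1 + 2 c m] and [|b|^2 = 1 + 2 d n], whence
[(|a|^2 - 1) (|b|^2 - 1) = -4 c d].

The vertex of the cone is [(d A + c B : c + d)] for the centres [A], [B], and the
section [sigma] is the conic with foci [a], [b] whose tangents [L] are given by
[dist(a, L) dist(b, L) = -c d] (signed distances).  With the plane identified
with the complex line, the relation above says exactly that the side lines of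
the triangle of roots of
[z (z - a) (z - b) = l (1 - a' z) (1 - b' z)], where [a'], [b'] are the conjugates
of [a], [b], are tangent to [sigma] for every [l]: these are the fibres of a
Blaschke product of degree 3.  All this is algebraic in isotropic coordinates, so
it persists for imaginary figures, and a generic [l] gives a proper triangle.
The argument breaks down only when the two factors have a common root, that is
when [alpha] and [beta] touch each other; then [sigma] is a double line, and any
triangle with vertices on [Sigma] and off that line will do. *)

(** * Triangles in the unit circle *)

Section BicentricTriangles.

Variable C : numClosedFieldType.

(** In characteristic zero the first [size p] naturals are distinct, one more than the roots that
    [p] can have. *)
Lemma poly_avoid_root (p : {poly C}) : p != 0 -> exists x, p.[x] != 0.
Proof.
move=> p0; pose s := [seq i%:R : C | i <- iota 0 (size p)].
have us : uniq s.
  by rewrite map_inj_uniq ?iota_uniq // => i j /eqP; rewrite eqr_nat => /eqP.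
have : ~~ all (root p) s.
  apply/negP => sp; have := max_poly_roots p0 sp us.
  by rewrite size_map size_iota ltnn.
by rewrite -has_predC => /hasP[x _ px]; exists x.
Qed.

Lemma poly_avoid_roots3 (p : {poly C}) : p != 0 ->
  exists t1 t2 t3, [/\ [/\ t1 != t2, t2 != t3 & t3 != t1],
    p.[t1] != 0, p.[t2] != 0 & p.[t3] != 0].
Proof.
move=> p0; have [t1 p1] := poly_avoid_root p0.
have p'0 : p * ('X - t1%:P) != 0 by rewrite mulf_neq0 ?polyXsubC_eq0.
have [t2] := poly_avoid_root p'0.
rewrite hornerM hornerXsubC mulf_eq0 negb_or subr_eq0 => /andP[p2 t21].
have p''0 : p * ('X - t1%:P) * ('X - t2%:P) != 0.
  by rewrite mulf_neq0 ?polyXsubC_eq0.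
have [t3] := poly_avoid_root p''0.
rewrite !hornerM !hornerXsubC !mulf_eq0 !negb_or !subr_eq0 -andbA.
move=> /and3P[p3 t31 t32].
by exists t1, t2, t3; rewrite p1 p2 p3 t31 eq_sym t21 eq_sym t32.
Qed.

Lemma vieta_cubic (s1 s2 s3 : C) : exists t1 t2 t3,
  [/\ t1 + t2 + t3 = s1, t1 * t2 + t2 * t3 + t3 * t1 = s2 & t1 * t2 * t3 = s3].
Proof.
have [t1 t1E] := @solve_monicpoly C 3 (nth 0 [:: s3; - s2; s1]) isT.
(* The coefficients are those of the quadratic left after dividing the cubic by [X - t1]; its other
   root is [s1 - t1 - t2]. *)
have [t2 t2E] := @solve_monicpoly C 2
  (nth 0 [:: t1 * (s1 - t1) - s2; s1 - t1]) isT.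
move: t1E t2E; rewrite !big_ord_recl !big_ord0 /= => t1E t2E.
have {}t1E : t1 * (s2 - t1 * (s1 - t1)) = s3.
  have -> : s3 = t1 ^+ 3 - s1 * t1 ^+ 2 + s2 * t1 by rewrite t1E; ring.
  by ring.
have {}t2E : t2 * (s1 - t1 - t2) = s2 - t1 * (s1 - t1).
  transitivity (t2 * (s1 - t1) - t2 ^+ 2); first by ring.
  by rewrite t2E; ring.
exists t1, t2, (s1 - t1 - t2); split; first by ring.
  by rewrite t2E; ring.
by rewrite -mulrA t2E.
Qed.

(* Isotropic coordinates: [(a, a')] and [(b, b')] are the points where the two
   spheres touch the plane (the foci), [k] is the product of the signed heights
   of their centres, and the unit circle is parametrized by [(t, 1/t)],
   homogeneously [(t^2, 1, t)].  Up to a factor, [conic_form] is the polar form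
   of the conic at two points of the circle. *)
Definition chord_form (a a' b b' k t : C) : C :=
  ((b - a) * (1 - a' * t) + (b' - a') * (t ^+ 2 - a * t)) / 2 - 2 * k * t.

(** Polarized squared distance to the focus [(a, a')]. It makes [conic_form] a focus-directrix
    equation, with [chord_form] as the directrix. *)
Definition focal_form (a a' s t : C) : C :=
  ((s ^+ 2 - s * a) * (1 - t * a') + (1 - s * a') * (t ^+ 2 - t * a)) / 2.

(* Vanishes exactly when the spheres are tangent to each other, the conic then
   being a double line. *)
Definition excess (a a' b b' k : C) : C := (a - b) * (a' - b') - 4 * k.

Definition conic_form (a a' b b' k s t : C) : C :=
  chord_form a a' b b' k s * chord_form a a' b b' k t
  - excess a a' b b' k * focal_form a a' s t.

(** The discriminant of the form on the chord vanishes; the second condition excludes chords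
    contained in the conic. *)
Definition tangent_chord (a a' b b' k s t : C) : Prop :=
  let q := conic_form a a' b b' k in
  q s t ^+ 2 = q s s * q t t /\ ~ [/\ q s s = 0, q s t = 0 & q t t = 0].

(** The chord has equation [z + s t z' = s + t], so the last factor vanishes when the product of the
    distances from the foci to the chord is [-k]. *)
Lemma conic_form_disc a a' b b' k s t :
  let q := conic_form a a' b b' k in
  q s t ^+ 2 - q s s * q t t =
    - (excess a a' b b' k * k * (s - t) ^+ 2 *
      ((a + s * t * a' - s - t) * (b + s * t * b' - s - t) + 4 * k * s * t)).
Proof.
rewrite /conic_form /focal_form /chord_form /excess /=; by field.
Qed.

(** A Gram determinant is the determinant of the form times a squared determinant of the points,
    here a Vandermonde. It is nonzero at three distinct points of the circle unless the conic
    degenerates. *)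
Lemma conic_form_gram a a' b b' k r s t :
  let q := conic_form a a' b b' k in
  q r r * (q s s * q t t - q s t ^+ 2) - q r s * (q r s * q t t - q s t * q r t)
    + q r t * (q r s * q s t - q s s * q r t) =
  - (excess a a' b b' k * k * ((r - s) * (s - t) * (t - r))) ^+ 2.
Proof.
rewrite /conic_form /focal_form /chord_form /excess /=; by field.
Qed.


Section Triangle.

Variables a a' b b' k : C.
Hypotheses (aa' : a * a' != 1) (bb' : b * b' != 1).
Hypothesis kE : 4 * k = - ((a * a' - 1) * (b * b' - 1)).

Let E := excess a a' b b' k.

Lemma half_distance_product_neq0 : k != 0.
Proof.
have : 4 * k != 0 by rewrite kE oppr_eq0 mulf_neq0 ?subr_eq0.
by rewrite mulf_eq0 pnatr_eq0.
Qed.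

(** Under [kE] the excess splits into the two conditions for the Blaschke factors to share a
    root. *)
Lemma excessE : E = (1 - a * b') * (1 - a' * b).
Proof. by rewrite /E /excess kE; ring. Qed.

(** The form becomes the product [chord_form s * chord_form t], a double line, and any chord with an
    endpoint off that line counts as tangent. *)
Lemma triangle_degenerate : E = 0 ->
  exists t1 t2 t3, [/\ [/\ t1 != t2, t2 != t3 & t3 != t1],
    tangent_chord a a' b b' k t1 t2, tangent_chord a a' b b' k t2 t3 &
    tangent_chord a a' b b' k t3 t1].
Proof.
move=> E0.
pose f : {poly C} := ((b - a) / 2)%:P * (1 - a'%:P * 'X)
   + ((b' - a') / 2)%:P * ('X^2 - a%:P * 'X) - (2 * k)%:P * 'X.
have fE t : f.[t] = chord_form a a' b b' k t.
  by rewrite /f /chord_form !hornerE; by field.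
(* The constant coefficient is [(b - a) / 2]; if it vanished, [E = 0] would force [k = 0]. *)
have f0 : f != 0.
  apply/eqP => f0; have := fE 0; rewrite f0 horner0 /chord_form => /esym ba.
  have {}ba : b - a = 0.
    transitivity (2 * (((b - a) * (1 - a' * 0) + (b' - a') * (0 ^+ 2 - a * 0)) / 2
       - 2 * k * 0)); first by field.
    by rewrite ba mulr0.
  have := half_distance_product_neq0; apply/negP; rewrite negbK.
  have : 4 * k = (a - b) * (a' - b') - E by rewrite /E /excess; ring.
  rewrite E0 subr0 -opprB ba oppr0 mul0r => /eqP.
  by rewrite mulf_eq0 pnatr_eq0.
have [t1 [t2 [t3 [tt f1 f2 f3]]]] := poly_avoid_roots3 f0.
have tc s t : f.[s] != 0 -> tangent_chord a a' b b' k s t.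
  move=> fs; rewrite /tangent_chord /conic_form -/E E0 -!fE !mul0r !subr0.
  by split=> [|[/eqP]]; [ring | rewrite mulf_eq0 (negPf fs)].
by exists t1, t2, t3; split=> //; apply: tc.
Qed.

Section Nondegenerate.

Hypothesis E_neq0 : E != 0.

Let ab' : 1 - a * b' != 0.
Proof. by apply: contra E_neq0 => /eqP h; rewrite excessE h mul0r. Qed.

Let a'b : 1 - a' * b != 0.
Proof. by apply: contra E_neq0 => /eqP h; rewrite excessE h mulr0. Qed.

(** The first three hypotheses are Vieta's relations for [z (z - a) (z - b) = l (1 - a' z) (1 - b'
    z)]. *)
Lemma tangent_chord_of_roots l t1 t2 t3 :
  t1 + t2 + t3 = a + b + l * (a' * b') ->
  t1 * t2 + t2 * t3 + t3 * t1 = a * b + l * (a' + b') ->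
  t1 * t2 * t3 = l ->
  t1 != t2 -> t2 != t3 -> t3 != t1 ->
  tangent_chord a a' b b' k t1 t2.
Proof.
move=> e1 e2 e3 t12 t23 t31; split.
  apply/eqP; rewrite -subr_eq0 conic_form_disc kE.
  (* With [l] replaced by [t1 t2 t3], the distance condition is a combination of the first two Vieta
     relations. *)
  have -> : (a + t1 * t2 * a' - t1 - t2) * (b + t1 * t2 * b' - t1 - t2)
      + - ((a * a' - 1) * (b * b' - 1)) * t1 * t2 =
    (t1 + t2 + t3 - (a + b + l * (a' * b'))) * (t1 + t2 - t1 * t2 * (a' + b'))
    - (t1 * t2 + t2 * t3 + t3 * t1 - (a * b + l * (a' + b')))
      * (1 - t1 * t2 * (a' * b')) by rewrite -e3; ring.
  by rewrite e1 e2 !subrr !mul0r subr0 mulr0 oppr0.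
(* A side contained in the conic would make the Gram determinant of the three vertices vanish. *)
case=> q11 q12 q22; have := conic_form_gram a a' b b' k t3 t1 t2.
rewrite /= q11 q12 q22 !(mulr0, mul0r, subr0, addr0, expr0n) /= => /esym/eqP.
rewrite oppr_eq0 sqrf_eq0 !mulf_eq0 -/E (negPf E_neq0).
rewrite (negPf half_distance_product_neq0) !subr_eq0.
by rewrite (negPf t12) (negPf t23) (negPf t31).
Qed.

(* [A / B] is the Blaschke product; the fibres with a double
   point are those over the values at the roots of [N]. *)
Let A : {poly C} := 'X * (('X - a%:P) * ('X - b%:P)).
Let B : {poly C} := (1 - a'%:P * 'X) * (1 - b'%:P * 'X).
Let N : {poly C} := A^`() * B - A * B^`().

Let AE t : A.[t] = t * ((t - a) * (t - b)).
Proof. by rewrite !hornerE. Qed.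

Let BE t : B.[t] = (1 - a' * t) * (1 - b' * t).
Proof. by rewrite !hornerE. Qed.

Let A'E t : A^`().[t] = (t - a) * (t - b) + t * (2 * t - a - b).
Proof. by rewrite !derivE !hornerE /=; ring. Qed.

Let B'E t : B^`().[t] = 2 * a' * b' * t - a' - b'.
Proof. by rewrite !derivE !hornerE /=; ring. Qed.

Let NE t : N.[t] = A^`().[t] * B.[t] - A.[t] * B^`().[t].
Proof. by rewrite -!hornerM -hornerN -hornerD. Qed.

Lemma blaschke_coprime t : A.[t] = 0 -> B.[t] != 0.
Proof.
rewrite AE BE => /eqP; rewrite mulf_eq0 mulf_eq0 !subr_eq0.
case/or3P => /eqP ->; rewrite ?mulr0 ?subr0 ?mulr1 ?oner_eq0 //.
  by rewrite ![_ * a]mulrC mulf_neq0 // subr_eq0 eq_sym.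
by rewrite [b' * b]mulrC mulf_neq0 // subr_eq0 eq_sym.
Qed.

(** If [N] vanished, every root of [A] would be multiple, [B] being nonzero there. This forces
    [a = b = 0], and then [N] has the nonzero term [3 t^2]. *)
Lemma blaschke_wronskian_neq0 : N != 0.
Proof.
apply/eqP => N0.
have W0 t : A^`().[t] * B.[t] - A.[t] * B^`().[t] = 0.
  by rewrite -NE N0 horner0.
have simple t : A.[t] = 0 -> A^`().[t] = 0.
  move=> At; have := W0 t; rewrite At mul0r subr0 => /eqP.
  by rewrite mulf_eq0 (negPf (blaschke_coprime At)) orbF => /eqP.
have := simple 0; rewrite AE A'E mul0r => /(_ erefl).
rewrite !sub0r mul0r addr0 mulrNN => /eqP ab0.
(* Here [c] and [d] are the two foci in either order; at [d] the derivative of [A] is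
   [d (d - c)]. *)
have simple_focus c d : (c == a) && (d == b) || (c == b) && (d == a) ->
    c == 0 -> d = 0.
  move=> cd /eqP c0.
  have := simple d; rewrite AE A'E.
  have -> : (d - a) * (d - b) = 0.
    by case/orP: cd => /andP[/eqP<- /eqP<-]; ring.
  have -> : 2 * d - a - b = d - c.
    by case/orP: cd => /andP[/eqP<- /eqP<-]; ring.
  by rewrite mulr0 add0r c0 subr0 => /(_ erefl) /eqP; rewrite mulf_eq0 orbb => /eqP.
have [a0 b0] : a = 0 /\ b = 0.
  move: ab0; rewrite mulf_eq0 => /orP[] h; move: (h) => /eqP ->; split=> //.
    by apply: simple_focus h; rewrite !eqxx.
  by apply: simple_focus h; rewrite !eqxx orbT.
have NE0 t : 3 * t ^+ 2 - 2 * (a' + b') * t ^+ 3 + a' * b' * t ^+ 4 = 0.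
  by rewrite -[RHS](W0 t) AE A'E BE B'E a0 b0; ring.
have : 36 = 0 :> C.
  (* The weights 12, 4, -1 at the points 1, -1, 2 cancel the cubic and quartic terms. *)
  transitivity (12 * (3 * 1 ^+ 2 - 2 * (a' + b') * 1 ^+ 3 + a' * b' * 1 ^+ 4)
    + 4 * (3 * (-1) ^+ 2 - 2 * (a' + b') * (-1) ^+ 3 + a' * b' * (-1) ^+ 4)
    - (3 * 2 ^+ 2 - 2 * (a' + b') * 2 ^+ 3 + a' * b' * 2 ^+ 4)); first by ring.
  by rewrite !NE0; ring.
by apply/eqP; rewrite pnatr_eq0.
Qed.

Lemma triangle_nondegenerate :
  exists t1 t2 t3, [/\ [/\ t1 != t2, t2 != t3 & t3 != t1],
    tangent_chord a a' b b' k t1 t2, tangent_chord a a' b b' k t2 t3 &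
    tangent_chord a a' b b' k t3 t1].
Proof.
have [r Nr] := closed_field_poly_normal N.
(* Take [l] outside the finitely many critical values, so that the cubic [A - l B] has no multiple
   root. *)
have [l] : exists l, (\prod_(t <- r) ('X - (A.[t] / B.[t])%:P)).[l] != 0.
  exact/poly_avoid_root/monic_neq0/monic_prod_XsubC.
rewrite horner_prod => lr.
have l_ok t : A.[t] = l * B.[t] -> A^`().[t] != l * B^`().[t].
  move=> At; apply/eqP => A't.
  have Bt : B.[t] != 0.
    apply/eqP => B0; have : A.[t] = 0 by rewrite At B0 mulr0.
    by move/blaschke_coprime; rewrite B0 eqxx.
  have rt : t \in r.
    rewrite -root_prod_XsubC -(rootZ _ _ (a := lead_coef N)); last first.
      by rewrite lead_coef_eq0 blaschke_wronskian_neq0.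
    by rewrite -Nr /root NE At A't; apply/eqP; ring.
  move/negP: lr; apply; rewrite prodf_seq_eq0; apply/hasP; exists t => //=.
  by rewrite hornerXsubC At mulfK ?subrr.
have [t1 [t2 [t3 [e1 e2 e3]]]] :=
  vieta_cubic (a + b + l * (a' * b')) (a * b + l * (a' + b')) l.
(* A repeated root would annihilate both [A - l B] and its derivative, against [l_ok]. *)
have distinct s1 s2 s3 : s1 + s2 + s3 = a + b + l * (a' * b') ->
    s1 * s2 + s2 * s3 + s3 * s1 = a * b + l * (a' + b') -> s1 * s2 * s3 = l ->
    s1 != s2.
  move=> h1 h2 h3; apply/eqP => s12; subst s2.
  have /eqP[] : A^`().[s1] != l * B^`().[s1].
    apply: l_ok; apply/eqP; rewrite -subr_eq0 AE BE; apply/eqP.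
    transitivity (s1 ^+ 2 * (s1 + s1 + s3 - (a + b + l * (a' * b')))
       - s1 * (s1 * s1 + s1 * s3 + s3 * s1 - (a * b + l * (a' + b')))
       + (s1 * s1 * s3 - l)); first by ring.
    by rewrite h1 h2 h3; ring.
  apply/eqP; rewrite -subr_eq0 A'E B'E; apply/eqP.
  transitivity (2 * s1 * (s1 + s1 + s3 - (a + b + l * (a' * b')))
     - (s1 * s1 + s1 * s3 + s3 * s1 - (a * b + l * (a' + b')))).
    by ring.
  by rewrite h1 h2; ring.
have e1' : t2 + t3 + t1 = a + b + l * (a' * b') by rewrite -e1; ring.
have e2' : t2 * t3 + t3 * t1 + t1 * t2 = a * b + l * (a' + b') by rewrite -e2; ring.
have e3' : t2 * t3 * t1 = l by rewrite -e3; ring.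
have e1'' : t3 + t1 + t2 = a + b + l * (a' * b') by rewrite -e1; ring.
have e2'' : t3 * t1 + t1 * t2 + t2 * t3 = a * b + l * (a' + b') by rewrite -e2; ring.
have e3'' : t3 * t1 * t2 = l by rewrite -e3; ring.
have t12 := distinct _ _ _ e1 e2 e3.
have t23 := distinct _ _ _ e1' e2' e3'.
have t31 := distinct _ _ _ e1'' e2'' e3''.
by exists t1, t2, t3; split=> //;
  [exact: tangent_chord_of_roots e1 e2 e3 _ _ _
  |exact: tangent_chord_of_roots e1' e2' e3' _ _ _
  |exact: tangent_chord_of_roots e1'' e2'' e3'' _ _ _].
Qed.

End Nondegenerate.

Lemma poncelet_triangle :
  exists t1 t2 t3, [/\ [/\ t1 != t2, t2 != t3 & t3 != t1],
    tangent_chord a a' b b' k t1 t2, tangent_chord a a' b b' k t2 t3 &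
    tangent_chord a a' b b' k t3 t1].
Proof.
have [/triangle_degenerate //|] := eqVneq E 0; exact: triangle_nondegenerate.
Qed.

End Triangle.
End BicentricTriangles.

(** * Real spheres tangent to a plane and a sphere *)

Section Dot.

Variable F : fieldType.
Implicit Types (u v w : 'rV[F]_3) (k : F).

Lemma dotE u v : dot u v = \sum_i u 0 i * v 0 i.
Proof. by rewrite /dot mxE; apply: eq_bigr => i _; rewrite mxE. Qed.

Lemma dotC u v : dot u v = dot v u.
Proof. by rewrite !dotE; apply: eq_bigr => i _; rewrite mulrC. Qed.

Lemma dotDr u v w : dot u (v + w) = dot u v + dot u w.
Proof. by rewrite /dot linearD mulmxDr mxE. Qed.

Lemma dotZr k u v : dot u (k *: v) = k * dot u v.
Proof. by rewrite /dot linearZ -scalemxAr mxE. Qed.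

Lemma dotNr u v : dot u (- v) = - dot u v.
Proof. by rewrite -scaleN1r dotZr mulN1r. Qed.

Lemma dotBr u v w : dot u (v - w) = dot u v - dot u w.
Proof. by rewrite dotDr dotNr. Qed.

Lemma dotDl u v w : dot (u + v) w = dot u w + dot v w.
Proof. by rewrite dotC dotDr !(dotC w). Qed.

Lemma dotZl k u v : dot (k *: u) v = k * dot u v.
Proof. by rewrite dotC dotZr dotC. Qed.

Lemma dotNl u v : dot (- u) v = - dot u v.
Proof. by rewrite dotC dotNr dotC. Qed.

Lemma dotBl u v w : dot (u - v) w = dot u w - dot v w.
Proof. by rewrite dotDl dotNl. Qed.

Lemma dot0r u : dot u 0 = 0.
Proof. by rewrite -(scale0r 0) dotZr mul0r. Qed.

Definition orthonormal3 (e1 e2 e3 : 'rV[F]_3) : Prop :=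
  [/\ dot e1 e1 = 1, dot e2 e2 = 1 & dot e3 e3 = 1] /\
  [/\ dot e1 e2 = 0, dot e1 e3 = 0 & dot e2 e3 = 0].

End Dot.

Section RealGeometry.

Variable R : realType.
Implicit Types (u v w x : 'rV[R]_3) (s t : sphere R).

Lemma dot_ge0 u : 0 <= dot u u.
Proof. by rewrite dotE sumr_ge0 // => i _; rewrite -expr2 sqr_ge0. Qed.

Lemma dot_eq0 u : (dot u u == 0) = (u == 0).
Proof.
apply/eqP/eqP => [|->]; last by rewrite dot0r.
rewrite dotE => /eqP; rewrite psumr_eq0 => [/allP h|i _]; last first.
  by rewrite -expr2 sqr_ge0.
apply/rowP => i; rewrite mxE; apply/eqP.
by have := h i (mem_index_enum _); rewrite mulf_eq0 orbb.
Qed.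

(** Two linear conditions in dimension three leave a nonzero solution, which is then normalized. *)
Lemma unit_orthogonal u v :
  exists e, [/\ dot e e = 1, dot u e = 0 & dot v e = 0].
Proof.
pose M := row_mx u^T v^T.
have : kermx M != 0.
  rewrite -mxrank_eq0 mxrank_ker subn_eq0 -ltnNge.
  exact: leq_ltn_trans (rank_leq_col M) _.
case/rowV0Pn => w /sub_kermxP wM w0.
have [wu wv] : dot w u = 0 /\ dot w v = 0.
  move: wM; rewrite /M mul_mx_row -row_mx0 => /eq_row_mx[wu wv].
  by rewrite /dot wu wv mxE.
have w_gt0 : 0 < dot w w by rewrite lt0r dot_eq0 w0 dot_ge0.
exists ((Num.sqrt (dot w w))^-1 *: w); rewrite !(dotZl, dotZr) (dotC u) (dotC v).
rewrite wu wv !mulr0; split=> //.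
by rewrite mulrA -invfM -expr2 sqr_sqrtr ?ltW // mulVf ?gt_eqF.
Qed.

Lemma orthonormal_expansion e1 e2 e3 x : orthonormal3 e1 e2 e3 ->
  x = dot x e1 *: e1 + dot x e2 *: e2 + dot x e3 *: e3.
Proof.
move=> [[e11 e22 e33] [e12 e13 e23]].
pose e (i : 'I_3) := nth 0 [:: e1; e2; e3] i.
pose M := \matrix_i e i.
have MMT : M *m M^T = 1%:M.
  apply/matrixP => i j; rewrite mxE.
  under eq_bigr do rewrite !mxE.
  rewrite -dotE mxE /e.
  case: i => -[|[|[|//]]] ?; case: j => -[|[|[|//]]] ? //=; by rewrite // dotC.
rewrite -[LHS]mulmx1 -(mulmx1C MMT) mulmxA mulmx_sum_row.
rewrite !big_ord_recl big_ord0 addr0 addrA !rowK /e /=.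
have xM i : (x *m M^T) 0 i = dot x (e i).
  by rewrite mxE dotE; apply: eq_bigr => j _; rewrite !mxE.
by rewrite !xM.
Qed.

Lemma orthonormal_frame (n : 'rV[R]_3) : n != 0 ->
  exists e1 e2 e3 k, [/\ orthonormal3 e1 e2 e3, k != 0 & n = k *: e3].
Proof.
move=> n0; have [e1 [e11 ne1 _]] := unit_orthogonal n n.
have [e2 [e22 ne2 e12]] := unit_orthogonal n e1.
have n_gt0 : 0 < dot n n by rewrite lt0r dot_eq0 n0 dot_ge0.
pose k := Num.sqrt (dot n n).
have k0 : k != 0 by rewrite gt_eqF // sqrtr_gt0.
exists e1, e2, (k^-1 *: n), k; split=> //; last by rewrite scalerA divff ?scale1r.
split; split; rewrite // !(dotZl, dotZr) ?(dotC _ n) ?ne1 ?ne2 ?mulr0 //.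
by rewrite mulrA -invfM -expr2 sqr_sqrtr ?ltW // mulVf ?gt_eqF.
Qed.

(** Let [z] be the part of [n] orthogonal to [v]. If [z] is nonzero, moving from [x] along [z] stays
    in the first plane while [dot n] takes every value, so the planes are neither equal nor
    disjoint. *)
Lemma parallel_normals v n x d : v != 0 ->
  parallel [set y | dot v (y - x) = 0] [set y | dot n y = d] ->
  exists k, n = k *: v.
Proof.
move=> v0 par; exists (dot n v / dot v v); apply/eqP; rewrite -subr_eq0.
set z := n - _; have vv0 : dot v v != 0 by rewrite dot_eq0.
have vz : dot v z = 0.
  by rewrite /z dotBr dotZr -mulrA mulVf // mulr1 dotC subrr.
have nz : dot n z = dot z z.
  by rewrite {3}/z dotBl dotZl vz mulr0 subr0.
rewrite -dot_eq0 -nz; case: par => [vn|vn].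
  have [nx nxz] : dot n x = d /\ dot n (x + z) = d.
    have inP y : dot v (y - x) = 0 -> dot n y = d.
      by move=> vy; have : [set y | dot n y = d] y by rewrite -vn.
    by split; apply: inP; rewrite ?subrr ?dot0r // addrC addKr.
  by move: nxz; rewrite dotDr nx => /eqP; rewrite -subr_eq0 addrC addKr.
apply: contraT => nz0; have : set0 (x + ((d - dot n x) / dot n z) *: z).
  rewrite -vn; split => /=; first by rewrite addrC addKr dotZr vz mulr0.
  by rewrite dotDr dotZr mulfVK // addrC subrK.
by [].
Qed.

(** Comparing the two ends of each diameter of [s] shows that the difference of the centres is
    orthogonal to every unit vector. Similitudes, given by images of point sets, can thus be read on
    centres and radii. *)
Lemma sphere_subset_inj s t : sphere_set s `<=` sphere_set t ->
  center s = center t /\ radius s = radius t.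
Proof.
move=> st; have rs := radius_gt0 s; have rt := radius_gt0 t.
have [w wE] : exists w, w = center s - center t by eexists.
have on e : dot e e = 1 ->
    dot w w + 2 * radius s * dot w e + radius s ^+ 2 = radius t ^+ 2.
  move=> e1; have : sphere_set t (center s + radius s *: e).
    apply: st; rewrite /sphere_set /= addrAC subrr add0r !(dotZl, dotZr) e1.
    by rewrite mulr1 expr2.
  rewrite /sphere_set /= addrAC -wE !(dotDl, dotDr, dotZl, dotZr) e1 => <-.
  by rewrite (dotC e w); ring.
have we e : dot e e = 1 -> dot w e = 0.
  move=> e1; have e1' : dot (- e) (- e) = 1 by rewrite dotNl dotNr opprK.
  have := on _ e1; have := on _ e1'; rewrite dotNr => h1 h2; apply/eqP.
  have : radius s * dot w e = 0 by lra.
  by move/eqP; rewrite mulf_eq0 gt_eqF.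
have w0 : w = 0.
  apply/eqP/contraT => /orthonormal_frame[e1 [e2 [e3 [k [[[_ _ e33] _] k0 wk]]]]].
  by have := we _ e33; rewrite wk dotZl e33 mulr1 => /eqP; rewrite (negPf k0).
have [e [ee _ _]] := unit_orthogonal 0 0.
have := on _ ee; rewrite w0 !(dotC 0) !dot0r mulr0 !add0r => /eqP.
rewrite eqrXn2 ?ltW // => /eqP; split=> //.
by apply/eqP; rewrite -subr_eq0 -wE w0.
Qed.

Lemma homothety_sphere s t x k : k != 0 ->
  [set x + k *: (y - x) | y in sphere_set s] = sphere_set t ->
  center t = x + k *: (center s - x) /\ radius t = `|k| * radius s.
Proof.
move=> k0 st; have r0 : 0 < `|k| * radius s.
  by rewrite mulr_gt0 ?normr_gt0 ?radius_gt0.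
have [|/= <- <- //] := @sphere_subset_inj (Sphere (x + k *: (center s - x)) r0) t.
move=> y ys; rewrite -st; move: ys; rewrite {1}/sphere_set /= => ys.
exists (x + k^-1 *: (y - x)) => /=; last first.
  by apply/rowP => i; rewrite !mxE; field.
rewrite /sphere_set /=.
have -> : x + k^-1 *: (y - x) - center s = k^-1 *: (y - (x + k *: (center s - x))).
  by apply/rowP => i; rewrite !mxE; field.
rewrite dotZl dotZr ys exprMn real_normK ?num_real //.
by field.
Qed.

Lemma translation_sphere s t u :
  [set y + u | y in sphere_set s] = sphere_set t ->
  center t = center s + u /\ radius t = radius s.
Proof.
move=> st; have [|/= <- <- //] := @sphere_subset_inj
  (Sphere (center s + u) (radius_gt0 s)) t.
move=> y ys; rewrite -st; move: ys; rewrite {1}/sphere_set /= => ys.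
by exists (y - u); rewrite /sphere_set /= ?subrK // -addrA -opprD [u + _]addrC.
Qed.

Lemma tangent_plane_normal s t x : sphere_set s x ->
  tangent_plane s x = tangent_plane t x ->
  exists k, x - center t = k *: (x - center s).
Proof.
move=> sx st.
have x0 : x - center s != 0.
  rewrite -dot_eq0; move: sx; rewrite /sphere_set /= => ->.
  by rewrite sqrf_eq0 gt_eqF ?radius_gt0.
apply: (@parallel_normals _ _ x (dot (x - center t) x)) => //; left.
rewrite -/(tangent_plane s x) st; apply/seteqP; split=> y /=.
  by rewrite /tangent_plane /= dotBr => /eqP; rewrite subr_eq0 => /eqP.
by rewrite /tangent_plane /= dotBr => ->; rewrite subrr.
Qed.

(** * Contact of spheres with the plane and with [gamma], in an orthonormal frame adapted to the
    plane *)

Section Frame.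

Variables (pi : plane R) (Sigma : circle pi) (e1 e2 e3 : 'rV[R]_3) (nu : R).
Hypotheses (e_ortho : orthonormal3 e1 e2 e3) (nu0 : nu != 0).
Hypothesis normalE : normal pi = nu *: e3.

Let o := ccenter Sigma.
Let rho := cradius Sigma.

Let e33 : dot e3 e3 = 1.
Proof. by case: e_ortho => [[]]. Qed.

Lemma plane_set_frame x : plane_set pi x <-> dot e3 (x - o) = 0.
Proof.
have := ccenter_in_plane Sigma; rewrite /plane_set /= normalE => <-.
by rewrite -/o !dotZl dotBr; split=> [/(mulfI nu0) ->|/eqP];
  rewrite ?subrr // subr_eq0 => /eqP ->.
Qed.

(** The number [c] is signed: it records the side on which the centre lies, so only its square is
    tied to the radius. *)
Lemma parallel_tangent_plane s x : sphere_set s x ->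
  parallel (tangent_plane s x) (plane_set pi) ->
  exists2 c, center s = x + c *: e3 & c ^+ 2 = radius s ^+ 2.
Proof.
move=> sx par; have x0 : x - center s != 0.
  rewrite -dot_eq0; move: sx; rewrite /sphere_set /= => ->.
  by rewrite sqrf_eq0 gt_eqF ?radius_gt0.
have [k] := parallel_normals x0 par; rewrite normalE => nk.
have k0 : k != 0.
  apply: contra_eq_neq nk => ->; rewrite scale0r scaler_eq0 (negPf nu0) /=.
  by rewrite -dot_eq0 e33 oner_eq0.
have xE : x - center s = (nu / k) *: e3.
  by rewrite mulrC -scalerA nk scalerA mulVf // scale1r.
exists (- (nu / k)).
  by rewrite scaleNr -xE; apply/rowP => i; rewrite !mxE; ring.
move: sx; rewrite /sphere_set /= xE dotZl dotZr e33 => <-; ring.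
Qed.

Lemma tangent_to_plane_frame s x : tangent_to_plane_at s pi x ->
  exists c, [/\ center s = x + c *: e3, c ^+ 2 = radius s ^+ 2 &
    dot e3 (x - o) = 0].
Proof.
move=> [sx tx]; have [c cE c2] := parallel_tangent_plane sx (or_introl tx).
exists c; split=> //; apply/plane_set_frame; rewrite -tx /tangent_plane /=.
by rewrite subrr dot0r.
Qed.

(** Comparing opposite points of the circle shows that [o - center s] is orthogonal to the plane;
    Pythagoras gives the radius. *)
Lemma circle_on_sphere s : circle_set Sigma `<=` sphere_set s ->
  exists2 h, center s = o + h *: e3 & radius s ^+ 2 = h ^+ 2 + rho ^+ 2.
Proof.
move=> cs; have rho0 : 0 < rho := cradius_gt0 Sigma.
have [w wE] : exists w, w = o - center s by eexists.
have on e : dot e e = 1 -> dot e3 e = 0 ->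
    dot w w + 2 * rho * dot w e + rho ^+ 2 = radius s ^+ 2.
  move=> e1' e3e; have : sphere_set s (o + rho *: e).
    apply: cs; split; first apply/plane_set_frame.
      by rewrite addrAC subrr add0r dotZr e3e mulr0.
    by rewrite addrAC subrr add0r !(dotZl, dotZr) e1' mulr1 expr2.
  rewrite /sphere_set /= addrAC -wE !(dotDl, dotDr, dotZl, dotZr) e1' => <-.
  by rewrite (dotC e w); ring.
have we e : dot e e = 1 -> dot e3 e = 0 -> dot w e = 0.
  move=> ee e3e; have ee' : dot (- e) (- e) = 1 by rewrite dotNl dotNr opprK.
  have e3e' : dot e3 (- e) = 0 by rewrite dotNr e3e oppr0.
  have := on _ ee e3e; have := on _ ee' e3e'; rewrite dotNr => h1 h2; apply/eqP.
  have : rho * dot w e = 0 by lra.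
  by move/eqP; rewrite mulf_eq0 gt_eqF.
case: (e_ortho) => [[e11 e22 _] [e12 e13 e23]].
have we1 : dot w e1 = 0 by apply: we; rewrite // dotC.
have we2 : dot w e2 = 0 by apply: we; rewrite // dotC.
have wE' := orthonormal_expansion w e_ortho.
rewrite we1 we2 !scale0r !add0r in wE'.
exists (- dot w e3).
  by rewrite scaleNr -wE' wE; apply/rowP => i; rewrite !mxE; ring.
have := on e1 e11; rewrite dotC e13 we1 => /(_ erefl) <-.
by rewrite {1 2}wE' dotZl dotZr e33; ring.
Qed.

(** Since [h + m] is the height of the pole [S] over the plane, this expresses the power of the
    contact point [x] with respect to the circle through that height and the signed height [c]. *)
Lemma tangent_class_frame s t S h m :
  center t = o + h *: e3 -> radius t ^+ 2 = h ^+ 2 + rho ^+ 2 ->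
  S = center t + m *: e3 -> m ^+ 2 = radius t ^+ 2 ->
  tangent_class t pi S s ->
  exists x c, [/\ center s = x + c *: e3, c ^+ 2 = radius s ^+ 2,
    dot e3 (x - o) = 0 & dot (x - o) (x - o) = rho ^+ 2 + 2 * c * (h + m)].
Proof.
move=> tE rt SE m2 [_ [p [x [[sp tp st] sx pS [k Sk]]]]].
have [c [sE c2 x0]] := tangent_to_plane_frame sx.
exists x, c; split=> //.
have [tau tauE] := tangent_plane_normal tp (esym st).
have rt0 : radius t ^+ 2 != 0 by rewrite sqrf_eq0 gt_eqF ?radius_gt0.
have [y yE] : exists y, y = p - center t by eexists.
rewrite -yE in tauE; move: sp tp; rewrite /sphere_set /= tauE -yE.
rewrite dotZl dotZr => sp yy; rewrite yy -m2 -c2 in sp.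
have xE : x - o = (h - c) *: e3 + (1 - tau) *: y.
  have -> : x = center s - c *: e3 by rewrite sE addrK.
  have -> : center s = p - tau *: y by rewrite -tauE opprB addrC subrK.
  have -> : p = y + o + h *: e3 by rewrite yE tE -addrA subrK.
  by apply/rowP => i; rewrite !mxE; ring.
have : (c - tau * m) * (c + tau * m) = 0.
  transitivity (c ^+ 2 - tau * (tau * m ^+ 2)); first by ring.
  by rewrite sp subrr.
(* The homothety with centre [p] and ratio [tau] carries [t] to [s]. It sends the pole opposite to
   [S] to [x] if [c = tau * m], and [S] itself to [x] if [c = - (tau * m)]. *)
move=> /eqP; rewrite mulf_eq0 => /orP[/eqP cm|/eqP cm].
  have {}cm : c = tau * m by apply/eqP; rewrite -subr_eq0 cm.
  have yk : (1 - k * tau) *: y = ((1 + k * tau) * m) *: e3.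
    have : m *: e3 - y = k *: (- tau *: y - c *: e3).
      have -> : m *: e3 - y = S - p.
        by rewrite SE yE; apply/rowP => i; rewrite !mxE; ring.
      rewrite Sk addrAC subrr add0r; congr (_ *: _).
      have -> : x = center s - c *: e3 by rewrite sE addrK.
      have -> : center s = p - tau *: y by rewrite -tauE opprB addrC subrK.
      by apply/rowP => i; rewrite !mxE; ring.
    rewrite cm => /rowP mk; apply/rowP => i; have := mk i; rewrite !mxE => mki.
    apply/eqP; rewrite -subr_eq0; apply/eqP.
    move/eqP: mki; rewrite -subr_eq0 => /eqP mki.
    by rewrite -[RHS]oppr0 -mki; ring.
  (* Comparing norms gives [k * tau = 0], hence [y = m *: e3] and [p = S], which the definition of
     the class excludes. *)
  have : dot ((1 - k * tau) *: y) ((1 - k * tau) *: y) =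
      ((1 + k * tau) * m) * ((1 + k * tau) * m) by rewrite yk dotZl dotZr e33 mulr1.
  rewrite dotZl dotZr yy -m2 => kt.
  have : (4 * m ^+ 2) * (k * tau) = 0.
    transitivity ((1 + k * tau) * m * ((1 + k * tau) * m) -
      (1 - k * tau) * ((1 - k * tau) * m ^+ 2)); first by ring.
    by rewrite kt subrr.
  rewrite m2 => /eqP; rewrite mulf_eq0 (mulf_eq0 4) pnatr_eq0 (negPf rt0) /=.
  move=> /eqP kt0.
  move: yk; rewrite kt0 subr0 addr0 scale1r mul1r => ym.
  by move: pS; rewrite SE -ym yE addrC subrK eqxx.
have {}cm : c = - (tau * m) by apply/eqP; rewrite -subr_eq0 opprK cm.
move: x0; rewrite xE !(dotDl, dotDr, dotZl, dotZr) e33 yy (dotC y) => x0.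
have rhoE : rho ^+ 2 = m ^+ 2 - h ^+ 2 by rewrite m2 rt; ring.
have {}x0 : (1 - tau) * dot e3 y = - (h - c).
  by apply/eqP; rewrite -subr_eq0 opprK addrC -x0 mulr1.
rewrite (mulrCA (1 - tau)) x0 rhoE -m2 cm; ring.
Qed.

End Frame.

End RealGeometry.

(** * Plane sections of circumscribed cones *)

Lemma polarized_sphere_lin (F : fieldType) (c u v v' : 'rV[F]_3)
    (q w t t' y z : F) :
  dot (u - w *: c) (y *: v + z *: v' - (y * t + z * t') *: c)
    - q * (w * (y * t + z * t')) =
  y * (dot (u - w *: c) (v - t *: c) - q * (w * t))
  + z * (dot (u - w *: c) (v' - t' *: c) - q * (w * t')).
Proof. by rewrite !(dotBr, dotDr, dotNr, dotZr); ring. Qed.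

Lemma affine_form_lin (F : fieldType) (q y z d d' w w' : F) :
  y * d + z * d' - q * (y * w + z * w') = y * (d - q * w) + z * (d' - q * w').
Proof. by ring. Qed.

Section Cone.
Local Open Scope complex_scope.

Variable R : realType.
Implicit Types (X Y Z V : 'rV[R[i]]_(3 + 1)) (k y z : R[i]).

Lemma mul_line X Y (D : 'rV_(1 + 1)) :
  D *m line X Y = D 0 0 *: X + D 0 1 *: Y.
Proof.
rewrite -[LHS]/(D *m col_mx X Y) -{1}[D]hsubmxK mul_row_col.
rewrite [lsubmx D]mx11_scalar [rsubmx D]mx11_scalar !mul_scalar_mx !mxE.
by congr (D _ _ *: _ + D _ _ *: _); apply: val_inj.
Qed.

Lemma sub_lineP X Y Z : (Z <= line X Y)%MS <-> exists y z, Z = y *: X + z *: Y.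
Proof.
split=> [/submxP[D ->]|[y [z ->]]]; first by rewrite mul_line; do 2 eexists.
apply/submxP; exists (\row_(i < 2) [:: y; z]`_i).
by rewrite mul_line !mxE.
Qed.

Lemma row_free_lineP X Y :
  row_free (line X Y) <-> forall y z, y *: X + z *: Y = 0 -> y = 0 /\ z = 0.
Proof.
split=> [/row_free_inj inj y z h|inj].
  have /rowP D0 : \row_(i < 2) [:: y; z]`_i = 0.
    by apply: inj; rewrite mul0mx mul_line !mxE.
  by have := D0 0; have := D0 1; rewrite !mxE.
apply: inj_row_free => D; rewrite mul_line => /inj[D0 D1].
by apply/rowP => -[[|[|//]] lt_i]; rewrite mxE;
  [rewrite -[RHS]D0|rewrite -[RHS]D1]; congr (D _ _); apply: val_inj.
Qed.

Lemma hpart_lin y z Y Z :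
  hpart (y *: Y + z *: Z) = y *: hpart Y + z *: hpart Z.
Proof. by apply/rowP => i; rewrite !mxE. Qed.

Lemma hweight_lin y z Y Z :
  hweight (y *: Y + z *: Z) = y * hweight Y + z * hweight Z.
Proof. by rewrite /hweight !mxE. Qed.

Lemma polar_formC c r X Y : polar_form c r X Y = polar_form c r Y X.
Proof. by rewrite /polar_form dotC (mulrC (hweight X)). Qed.

Lemma polar_form_lin c r y z X Y Z :
  polar_form c r X (y *: Y + z *: Z) =
  y * polar_form c r X Y + z * polar_form c r X Z.
Proof.
by rewrite /polar_form hpart_lin hweight_lin polarized_sphere_lin.
Qed.

Definition plane_form (pi : plane R) X : R[i] :=
  dot (toC (normal pi)) (hpart X) - (offset pi)%:C * hweight X.

Lemma planeCP pi X : planeC pi X <-> X != 0 /\ plane_form pi X = 0.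
Proof.
rewrite /planeC /plane_form /=; split=> -[-> h]; split=> //.
  by rewrite h subrr.
by apply/eqP; rewrite -subr_eq0 h.
Qed.

Lemma plane_form_lin pi y z X Y :
  plane_form pi (y *: X + z *: Y) = y * plane_form pi X + z * plane_form pi Y.
Proof.
by rewrite /plane_form hpart_lin hweight_lin dotDr !dotZr affine_form_lin.
Qed.

(** Polarized Joachimsthal form: on the diagonal it vanishes when the form of the sphere is
    degenerate on the line [VX]. *)
Definition cone_form (s : sphere R) V X Y : R[i] :=
  let P := polar_form (center s) (radius s) in
  P V X * P V Y - P V V * P X Y.

(** A point of contact is a kernel vector of the 2 x 2 Gram matrix of the sphere's form on the line,
    so one exists exactly when the determinant vanishes. *)
Lemma circumscribed_coneP s V X : row_free (line V X) ->
  circumscribed_cone s V X <-> cone_form s V X X = 0.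
Proof.
move=> VX; have /row_free_lineP VX0 := VX.
have X0 : X != 0.
  apply/eqP => X0; have /VX0[_ /eqP] : 0 *: V + 1 *: X = 0.
    by rewrite X0 scaler0 scale0r addr0.
  by rewrite oner_eq0.
have V0 : V != 0.
  apply/eqP => V0; have /VX0[/eqP + _] : 1 *: V + 0 *: X = 0.
    by rewrite V0 scaler0 scale0r addr0.
  by rewrite oner_eq0.
rewrite /circumscribed_cone /cone_form /tangent_line_sphere /=.
have PC := polar_formC (center s) (radius s).
have Plin := polar_form_lin (center s) (radius s).
move: (polar_form _ _) PC Plin => P PC Plin.
split=> [[_ [L [Lf VL XL [T [T0 TL TP]]]]]|disc].
  have VXL : (line V X <= L)%MS.
    by apply/rV_subP => Z /sub_lineP[y [z ->]]; rewrite addmx_sub ?scalemx_sub.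
  have LVX : (L <= line V X)%MS.
    by rewrite -(mxrank_leqif_sup VXL) (eqP VX) (eqP Lf).
  have /sub_lineP[y [z TE]] := submx_trans TL LVX.
  have := TP _ VL; have := TP _ XL; rewrite !(PC T) TE.
  rewrite !Plin (PC X V) => hX hV.
  have [y0|z0] : y != 0 \/ z != 0.
    have [y0|] := eqVneq y 0; last by left.
    have [z0|] := eqVneq z 0; last by right.
    by move: T0; rewrite TE y0 z0 !scale0r addr0 eqxx.
  - apply: (mulfI y0); rewrite mulr0.
    transitivity ((y * P V X + z * P X X) * P V X
      - (y * P V V + z * P V X) * P X X); first by ring.
    by rewrite hX hV !mul0r subrr.
  apply: (mulfI z0); rewrite mulr0.
  transitivity ((y * P V V + z * P V X) * P V X
    - (y * P V X + z * P X X) * P V V); first by ring.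
  by rewrite hX hV !mul0r subrr.
split=> //; exists (line V X); split=> //.
- by apply/sub_lineP; exists 1, 0; rewrite scale1r scale0r addr0.
- by apply/sub_lineP; exists 0, 1; rewrite scale1r scale0r add0r.
(* The kernel contains [V] if the first row of the Gram matrix is zero, and otherwise the vector
   orthogonal to that row. *)
have [[PVV PVX]|PV0] : P V V = 0 /\ P V X = 0 \/ ~ (P V V = 0 /\ P V X = 0).
  have [h|h] := eqVneq (P V V) 0; last by right=> -[/eqP]; rewrite (negPf h).
  by have [h'|h'] := eqVneq (P V X) 0; [left|right=> -[_ /eqP]; rewrite (negPf h')].
- exists V; split=> // [|Y /sub_lineP[y [z ->]]].
    by apply/sub_lineP; exists 1, 0; rewrite scale1r scale0r addr0.
  by rewrite Plin PVV PVX !mulr0 addr0.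
exists (P V X *: V + - P V V *: X); split=> [||Y /sub_lineP[y [z ->]]].
- apply/eqP => /VX0[h /eqP]; rewrite oppr_eq0 => /eqP h'.
  exact: PV0.
- by apply/sub_lineP; do 2 eexists.
rewrite PC Plin !(PC (y *: V + _)) !Plin (PC X V).
transitivity (z * (P V X * P V X - P V V * P X X)); first by ring.
by rewrite disc mulr0.
Qed.

Lemma circumscribed_cone_eqmx s V V' : (V == V')%MS ->
  circumscribed_cone s V = circumscribed_cone s V'.
Proof.
move=> /eqmxP VV'; apply/seteqP.
by split=> X [X0 [L [Lf VL XL LT]]]; split=> //; exists L; split=> //;
  [rewrite -VV'|rewrite VV'].
Qed.

Section PlaneSection.

Variables (pi : plane R) (s : sphere R) (V : 'rV[R[i]]_(3 + 1)).
Hypothesis V_pi : plane_form pi V != 0.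

Let sigma := circumscribed_cone s V `&` planeC pi.
Let Q := cone_form s V.

(** As [V] is off the plane, it is independent of every point [X] of the plane, so
    [circumscribed_coneP] applies. *)
Lemma cone_sectionP X : sigma X <-> planeC pi X /\ Q X X = 0.
Proof.
have main : planeC pi X -> circumscribed_cone s V X <-> Q X X = 0.
  move=> /planeCP[X0 Xpi]; apply: circumscribed_coneP; apply/row_free_lineP.
  move=> y z VX; have y0 : y = 0.
    have := congr1 (plane_form pi) VX; rewrite plane_form_lin Xpi mulr0 addr0.
    have -> : plane_form pi 0 = 0.
      rewrite -[0](addr0 0) -{1}(scale0r V) -(scale0r V).
      by rewrite plane_form_lin !mul0r addr0.
    by move/eqP; rewrite mulf_eq0 (negPf V_pi) orbF => /eqP.
  split=> //; move/eqP: VX; rewrite y0 scale0r add0r scaler_eq0 (negPf X0) orbF.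
  by move/eqP.
by split=> [[h hp]|[hp h]]; split=> //; apply/main.
Qed.

Lemma cone_formC X Y : Q X Y = Q Y X.
Proof. by rewrite /Q /cone_form mulrC (polar_formC _ _ X). Qed.

Lemma cone_form_lin X Y Z y z : Q X (y *: Y + z *: Z) = y * Q X Y + z * Q X Z.
Proof. rewrite /Q /cone_form !polar_form_lin; ring. Qed.

Lemma cone_form_line X Y y z : Q (y *: X + z *: Y) (y *: X + z *: Y) =
  y ^+ 2 * Q X X + 2 * y * z * Q X Y + z ^+ 2 * Q Y Y.
Proof.
rewrite cone_form_lin !(cone_formC (y *: X + _)) !cone_form_lin (cone_formC Y X).
ring.
Qed.

(** On the line the form is a nonzero multiple of a square, whose only zero is the point of contact:
    [X] if [Q X X = 0], and [- Q X Y *: X + Q X X *: Y] otherwise. *)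
Lemma tangent_line_cone_section X Y : planeC pi X -> planeC pi Y ->
  row_free (line X Y) ->
  Q X Y ^+ 2 = Q X X * Q Y Y -> ~ [/\ Q X X = 0, Q X Y = 0 & Q Y Y = 0] ->
  tangent_line_conic sigma (line X Y).
Proof.
move=> /planeCP[X0 Xpi] /planeCP[Y0 Ypi] /row_free_lineP XY disc nz.
have pi_line y z : plane_form pi (y *: X + z *: Y) = 0.
  by rewrite plane_form_lin Xpi Ypi !mulr0 addr0.
have [QX|QX] := eqVneq (Q X X) 0.
  have QXY : Q X Y = 0 by apply/eqP; rewrite -sqrf_eq0 disc QX mul0r.
  have QY : Q Y Y != 0 by apply/eqP => h; exact: nz.
  exists X; split.
  - by apply/sub_lineP; exists 1, 0; rewrite scale1r scale0r addr0.
  - by apply/cone_sectionP; split=> //; apply/planeCP.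
  move=> Z /sub_lineP[y [z ->]] /cone_sectionP[/planeCP[Z0 _]].
  rewrite cone_form_line QX QXY !mulr0 !add0r => /eqP.
  rewrite mulf_eq0 (negPf QY) orbF sqrf_eq0 => /eqP z0.
  move: Z0; rewrite z0 scale0r addr0 scaler_eq0 negb_or => /andP[y0 _].
  by split=> //; apply/eqmxP/eqmx_sym/eqmx_scale.
pose P := - Q X Y *: X + Q X X *: Y.
have P0 : P != 0 by apply/eqP => /XY[_ /eqP]; rewrite (negPf QX).
exists P; split.
- by apply/sub_lineP; do 2 eexists.
- apply/cone_sectionP; split; first by apply/planeCP; split=> //; apply: pi_line.
  rewrite cone_form_line.
  transitivity (- Q X X * (Q X Y ^+ 2 - Q X X * Q Y Y)); first by ring.
  by rewrite disc subrr mulr0.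
move=> Z /sub_lineP[y [z ZE]] /cone_sectionP[/planeCP[Z0 _]].
rewrite ZE cone_form_line => QZ.
have yz : Q X X * y + Q X Y * z = 0.
  apply/eqP; rewrite -sqrf_eq0; apply/eqP.
  transitivity (Q X X * (y ^+ 2 * Q X X + 2 * y * z * Q X Y + z ^+ 2 * Q Y Y)
    + z ^+ 2 * (Q X Y ^+ 2 - Q X X * Q Y Y)); first by ring.
  by rewrite QZ disc subrr !mulr0 addr0.
have ZP : Q X X *: Z = z *: P.
  have -> : z *: P = Q X X *: Z - (Q X X * y + Q X Y * z) *: X.
    by rewrite /P ZE; apply/rowP => i; rewrite !mxE; ring.
  by rewrite yz scale0r subr0.
have z0 : z != 0.
  apply: contra_neq Z0 => z0; move: yz; rewrite z0 mulr0 addr0 => /eqP.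
  by rewrite mulf_eq0 (negPf QX) ZE z0 => /eqP ->; rewrite !scale0r addr0.
split=> //; apply/eqmxP.
apply: (eqmx_trans (eqmx_sym (eqmx_scale P z0))).
by rewrite -ZP -ZE; apply: eqmx_scale.
Qed.

End PlaneSection.
End Cone.

(** * Isotropic coordinates *)

Section Isotropic.

Variable F : numFieldType.
(** The value [2^-1] gives [u *: e + v *: e'] the squared length [u v], as for [u = x + i y] and
    [v = x - i y]. *)
Definition isotropic_frame (e e' f : 'rV[F]_3) : Prop :=
  [/\ dot e e = 0, dot e' e' = 0 & dot e e' = 2^-1] /\
  [/\ dot e f = 0, dot e' f = 0 & dot f f = 1].

Lemma isotropic_dot (e e' f : 'rV[F]_3) (u v z u' v' z' : F) :
  isotropic_frame e e' f ->
  dot (u *: e + v *: e' + z *: f) (u' *: e + v' *: e' + z' *: f) =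
  (u * v' + v * u') / 2 + z * z'.
Proof.
move=> [[ee e'e' ee'] [ef e'f ff]]; rewrite !(dotDl, dotDr, dotZl, dotZr).
rewrite (dotC e' e) (dotC f e) (dotC f e') ee e'e' ee' ef e'f ff.
by field.
Qed.

(* The vector part of the point with homogeneous coordinates [(u, v, z, w)]. *)
Definition frame_vec (o e e' f : 'rV[F]_3) (u v z w : F) : 'rV[F]_3 :=
  w *: o + (u *: e + v *: e' + z *: f).

Lemma frame_vec_lin (o e e' f : 'rV[F]_3) (y k u v z w u' v' z' w' : F) :
  y *: frame_vec o e e' f u v z w + k *: frame_vec o e e' f u' v' z' w' =
  frame_vec o e e' f
    (y * u + k * u') (y * v + k * v') (y * z + k * z') (y * w + k * w').
Proof. by apply/rowP => j; rewrite !mxE; ring. Qed.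

Lemma frame_vec_dot (o e e' f : 'rV[F]_3) (a a' c u v z w u' v' z' w' : F) :
  isotropic_frame e e' f ->
  dot (frame_vec o e e' f u v z w - w *: frame_vec o e e' f a a' c 1)
      (frame_vec o e e' f u' v' z' w' - w' *: frame_vec o e e' f a a' c 1) =
  ((u - w * a) * (v' - w' * a') + (v - w * a') * (u' - w' * a)) / 2
  + (z - w * c) * (z' - w' * c).
Proof.
move=> fr; rewrite -(isotropic_dot _ _ _ _ _ _ fr).
by congr dot; apply/rowP => j; rewrite !mxE; ring.
Qed.

Lemma isotropic_frame_free (e e' f : 'rV[F]_3) (u v z : F) :
  isotropic_frame e e' f -> u *: e + v *: e' + z *: f = 0 ->
  [/\ u = 0, v = 0 & z = 0].
Proof.
move=> [[ee e'e' ee'] [ef e'f ff]] h0.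
have := congr1 (dot e) h0; have := congr1 (dot e') h0; have := congr1 (dot f) h0.
rewrite !dot0r !dotDr !dotZr (dotC f e) (dotC f e') (dotC e' e).
rewrite ee e'e' ee' ef e'f ff !(mulr0, addr0, add0r) mulr1 => -> /eqP + /eqP.
by rewrite !mulf_eq0 !invr_eq0 !pnatr_eq0 !orbF => /eqP-> /eqP->.
Qed.

Lemma frame_vec_height (o e e' f : 'rV[F]_3) (u v z w : F) :
  isotropic_frame e e' f -> dot f (frame_vec o e e' f u v z w) = w * dot f o + z.
Proof.
move=> [_ [ef e'f ff]]; rewrite /frame_vec !dotDr !dotZr (dotC f e) (dotC f e').
by rewrite ef e'f ff !mulr0 !add0r mulr1.
Qed.

Lemma vandermonde3 (r t1 t2 t3 x y z : F) : r != 0 ->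
  t1 != t2 -> t2 != t3 -> t3 != t1 ->
  r * (x + y + z) = 0 -> x * t1 + y * t2 + z * t3 = 0 ->
  r * (x * t1 ^+ 2 + y * t2 ^+ 2 + z * t3 ^+ 2) = 0 ->
  [/\ x = 0, y = 0 & z = 0].
Proof.
move=> r0 t12 t23 t31 /eqP + v1 /eqP.
rewrite !mulf_eq0 (negPf r0) /= => /eqP v0 /eqP v2.
have vdm (s1 s2 s3 x1 x2 x3 : F) : x1 + x2 + x3 = 0 ->
    x1 * s1 + x2 * s2 + x3 * s3 = 0 ->
    x1 * s1 ^+ 2 + x2 * s2 ^+ 2 + x3 * s3 ^+ 2 = 0 ->
    s1 != s2 -> s3 != s1 -> x1 = 0.
  (* The relations are combined by the quadratic [- (t - s2) (t - s3)], which isolates [x1]. *)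
  move=> k0 k1 k2 s12 s31; have : x1 * ((s1 - s2) * (s3 - s1)) = 0.
    transitivity (- (x1 * s1 ^+ 2 + x2 * s2 ^+ 2 + x3 * s3 ^+ 2)
      + (s2 + s3) * (x1 * s1 + x2 * s2 + x3 * s3)
      - s2 * s3 * (x1 + x2 + x3)); first by ring.
    by rewrite k0 k1 k2 !mulr0 subr0 addr0 oppr0.
  by move/eqP; rewrite !mulf_eq0 !subr_eq0 (negPf s12) (negPf s31) !orbF => /eqP.
have x0 := vdm _ _ _ _ _ _ v0 v1 v2 t12 t31.
have y0 : y = 0.
  by apply: (vdm t2 t3 t1 y z x) t23 t12;
    [rewrite -v0|rewrite -v1|rewrite -v2]; ring.
by split=> //; move: v0; rewrite x0 y0 !add0r.
Qed.

Lemma circle_point_power (r t : F) :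
  ((r * t ^+ 2 - t * 0) * (r - t * 0) + (r - t * 0) * (r * t ^+ 2 - t * 0)) / 2
  + (0 - t * 0) * (0 - t * 0) - r ^+ 2 * (t * t) = 0.
Proof. by field. Qed.

End Isotropic.


Definition isotropic (C : numClosedFieldType) (e1 e2 : 'rV[C]_3) : 'rV[C]_3 :=
  2^-1 *: (e1 + 'i *: e2).

Lemma orthonormal_isotropic (C : numClosedFieldType) (e1 e2 e3 : 'rV[C]_3) :
  orthonormal3 e1 e2 e3 ->
  isotropic_frame (isotropic e1 (- e2)) (isotropic e1 e2) e3.
Proof.
move=> [[e11 e22 e33] [e12 e13 e23]].
have i2 x : 'i * ('i * x) = - x :> C by rewrite mulrA -expr2 sqrCi mulN1r.
rewrite /isotropic_frame /isotropic.
rewrite !(dotDl, dotDr, dotZl, dotZr) !(dotNl, dotNr).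
rewrite (dotC e2 e1) e11 e22 e12 e13 e23 e33.
rewrite !(mulr0, oppr0, addr0, add0r, opprK, mulrN, mulrCA 'i 2^-1, i2).
by split; split=> //; field.
Qed.

Lemma isotropic_expansion (C : numClosedFieldType) (e1 e2 : 'rV[C]_3) (x y : C) :
  x *: e1 + y *: e2 =
  (x + 'i * y) *: isotropic e1 (- e2) + (x - 'i * y) *: isotropic e1 e2.
Proof.
have i2 : 'i * 'i = -1 :> C by rewrite -expr2 sqrCi.
apply/rowP => j; rewrite !mxE.
have {1}-> : y * e2 0 j = - ('i * 'i) * y * e2 0 j by rewrite i2; ring.
by field.
Qed.

(** Here [P] is the polar form of the sphere of centre [(r a, r a', c)] tangent to the plane, [PV]
    fixes its first argument at the cone's vertex, and dividing lengths by [r] turns the circle into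
    the unit circle. *)
Lemma cone_form_conic_form (C : numClosedFieldType) (a a' b b' c d r s t : C) :
  r != 0 ->
  let P u v z w u' v' z' w' := ((u - w * (r * a)) * (v' - w' * (r * a'))
    + (v - w * (r * a')) * (u' - w' * (r * a))) / 2
    + (z - w * c) * (z' - w' * c) - c ^+ 2 * (w * w') in
  let PV := P (c * (r * b) + d * (r * a)) (c * (r * b') + d * (r * a'))
    (2 * c * d) (c + d) in
  PV (r * s ^+ 2) r 0 s * PV (r * t ^+ 2) r 0 t
  - PV (c * (r * b) + d * (r * a)) (c * (r * b') + d * (r * a'))
    (2 * c * d) (c + d) * P (r * s ^+ 2) r 0 s (r * t ^+ 2) r 0 t =
  (r ^+ 2 * c) ^+ 2 * conic_form a a' b b' (c * d / r ^+ 2) s t.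
Proof.
by move=> r0 /=; rewrite /conic_form /chord_form /focal_form /excess; field.
Qed.

(** * Complex points in isotropic coordinates and the rational parametrization of the circle *)

Section Points.
Local Open Scope complex_scope.

Variable R : realType.

Lemma dot_toC (u v : 'rV[R]_3) : dot (toC u) (toC v) = (dot u v)%:C.
Proof.
by rewrite !dotE rmorph_sum; apply: eq_bigr => i _; rewrite !mxE rmorphM.
Qed.

Lemma orthonormal_toC (e1 e2 e3 : 'rV[R]_3) :
  orthonormal3 e1 e2 e3 -> orthonormal3 (toC e1) (toC e2) (toC e3).
Proof.
by rewrite /orthonormal3 !dot_toC; case=> [[-> -> ->] [-> -> ->]].
Qed.


Lemma planeC_same_point pi (V W : 'rV[R[i]]_(3 + 1)) :
  same_point V W -> planeC pi W -> planeC pi V.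
Proof.
move=> [V0 /andP[/sub_rVP[k VE] _]] /planeCP[_ W0].
apply/planeCP; split=> //; rewrite VE -[k *: W]addr0 -(scale0r W).
by rewrite plane_form_lin W0 !mulr0 addr0.
Qed.

Section Coordinates.

Variables (pi : plane R) (Sigma : circle pi) (e1 e2 e3 : 'rV[R]_3) (nu : R).
Hypotheses (e_ortho : orthonormal3 e1 e2 e3) (nu0 : nu != 0).
Hypothesis normalE : normal pi = nu *: e3.

Let o := ccenter Sigma.
Let rho := cradius Sigma.
Let eps := isotropic (toC e1) (- toC e2).
Let eps' := isotropic (toC e1) (toC e2).

Let frame : isotropic_frame eps eps' (toC e3).
Proof. exact/orthonormal_isotropic/orthonormal_toC. Qed.

Definition hpoint (u v z w : R[i]) : 'rV[R[i]]_(3 + 1) :=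
  row_mx (frame_vec (toC o) eps eps' (toC e3) u v z w) w%:M.

Lemma hpart_hpoint u v z w :
  hpart (hpoint u v z w) = frame_vec (toC o) eps eps' (toC e3) u v z w.
Proof. by rewrite /hpart row_mxKl. Qed.

Lemma hweight_hpoint u v z w : hweight (hpoint u v z w) = w.
Proof. by rewrite /hweight row_mxKr mxE eqxx mulr1n. Qed.

Lemma hpoint_lin y k u v z w u' v' z' w' :
  y *: hpoint u v z w + k *: hpoint u' v' z' w' =
  hpoint (y * u + k * u') (y * v + k * v') (y * z + k * z') (y * w + k * w').
Proof.
rewrite /hpoint !scale_row_mx add_row_mx frame_vec_lin; congr row_mx.
by rewrite !scale_scalar_mx -raddfD.
Qed.

Lemma hpoint_eq0 u v z w : hpoint u v z w = 0 -> [/\ u = 0, v = 0, z = 0 & w = 0].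
Proof.
rewrite /hpoint -row_mx0 => /eq_row_mx[h0 /matrixP/(_ 0 0)].
rewrite !mxE eqxx mulr1n => w0; move: h0.
rewrite /frame_vec w0 scale0r add0r.
by move=> /(isotropic_frame_free frame)[-> -> ->].
Qed.

Lemma toC_frame_vec (a1 a2 c : R) :
  toC (o + (a1 *: e1 + a2 *: e2) + c *: e3) =
  frame_vec (toC o) eps eps' (toC e3)
    (a1%:C + 'i * a2%:C) (a1%:C - 'i * a2%:C) c%:C 1.
Proof.
rewrite /frame_vec -isotropic_expansion scale1r.
by apply/rowP => j; rewrite !mxE !rmorphD !rmorphM !addrA.
Qed.

Lemma polar_form_hpoint (a1 a2 c r : R) u v z w u' v' z' w' :
  let a := a1%:C + 'i * a2%:C in let a' := a1%:C - 'i * a2%:C in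
  polar_form (o + (a1 *: e1 + a2 *: e2) + c *: e3) r
     (hpoint u v z w) (hpoint u' v' z' w') =
  ((u - w * a) * (v' - w' * a') + (v - w * a') * (u' - w' * a)) / 2
  + (z - w * c%:C) * (z' - w' * c%:C) - (r ^+ 2)%:C * (w * w').
Proof.
move=> a a'; rewrite /polar_form !hpart_hpoint !hweight_hpoint.
by rewrite toC_frame_vec frame_vec_dot.
Qed.

Lemma plane_form_hpoint u v z w : plane_form pi (hpoint u v z w) = nu%:C * z.
Proof.
rewrite /plane_form hpart_hpoint hweight_hpoint.
have <- := ccenter_in_plane Sigma; rewrite -/o -dot_toC.
have -> : toC (normal pi) = nu%:C *: toC e3.
  by rewrite normalE; apply/rowP => j; rewrite !mxE rmorphM.
rewrite !dotZl frame_vec_height // mulrDr mulrCA [w * _]mulrC.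
by rewrite addrAC subrr add0r.
Qed.

(* For [t = 0] this is a circular point at infinity. *)
Definition circle_point (t : R[i]) := hpoint (rho%:C * t ^+ 2) rho%:C 0 t.

Let rhoC : rho%:C != 0 :> R[i].
Proof. by rewrite fmorph_eq0 gt_eqF ?cradius_gt0. Qed.

Lemma planeC_circle_point t : planeC pi (circle_point t).
Proof.
apply/planeCP; split; last by rewrite plane_form_hpoint mulr0.
by apply/eqP => /hpoint_eq0[_ /eqP]; rewrite (negPf rhoC).
Qed.

Lemma circleC_circle_point t : circleC Sigma (circle_point t).
Proof.
split; first exact: planeC_circle_point.
have := polar_form_hpoint 0 0 0 rho (rho%:C * t ^+ 2) rho%:C 0 t
  (rho%:C * t ^+ 2) rho%:C 0 t.
rewrite !scale0r !addr0 /= -/(circle_point t) => ->.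
by rewrite !rmorph0 rmorphXn mulr0 addr0 subr0 circle_point_power.
Qed.

Lemma circle_point_line s t :
  s != t -> row_free (line (circle_point s) (circle_point t)).
Proof.
move=> st; apply/row_free_lineP => y z; rewrite hpoint_lin => /hpoint_eq0[_ h _ h'].
have zE : z = - y.
  apply/eqP; rewrite -addr_eq0 addrC; apply/eqP/(mulIf rhoC).
  by rewrite mulrDl h mul0r.
move/eqP: h'; rewrite zE mulNr -mulrBr mulf_eq0 subr_eq0 (negPf st) orbF.
by move=> /eqP->; rewrite oppr0.
Qed.

Lemma circle_point_triangle t1 t2 t3 : t1 != t2 -> t2 != t3 -> t3 != t1 ->
  row_free
    (col_mx (circle_point t1) (col_mx (circle_point t2) (circle_point t3))).
Proof.
move=> t12 t23 t31; apply: inj_row_free => W.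
rewrite -[W]hsubmxK -[rsubmx W]hsubmxK !mul_row_col.
rewrite [lsubmx W]mx11_scalar [lsubmx (rsubmx W)]mx11_scalar.
rewrite [rsubmx (rsubmx W)]mx11_scalar !mul_scalar_mx.
move: (lsubmx W 0 0) (lsubmx (rsubmx W) 0 0) (rsubmx (rsubmx W) 0 0) => x y z.
rewrite hpoint_lin -[X in _ + X]scale1r hpoint_lin !mul1r.
move=> /hpoint_eq0[h2 h0 _ h1].
rewrite addrA in h1; have [||-> -> ->] := vandermonde3 rhoC t12 t23 t31 _ h1.
- by rewrite -addrA !mulrDr !(mulrC rho%:C).
- by rewrite -h2 -addrA !mulrDr !(mulrCA rho%:C).
by rewrite !raddf0 row_mx0 row_mx0.
Qed.

End Coordinates.
End Points.

(** * The vertex of the cone *)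

Section SimilitudeCentre.
Local Open Scope complex_scope.

Variable R : realType.

(* The centre of similitude off the plane, for centres at signed heights [c] and
   [d]; it is at infinity when [c + d = 0]. *)
Definition weighted_centre (s t : sphere R) (c d : R) : 'rV[R[i]]_(3 + 1) :=
  row_mx (toC (c *: center t + d *: center s)) (c + d)%:C%:M.

Lemma eqmx_same_point (V W W' : 'rV[R[i]]_(3 + 1)) k :
  same_point V W -> k != 0 -> W' = k *: W -> (V == W')%MS.
Proof.
move=> [_ /eqmxP VW] k0 ->; apply/eqmxP.
exact: eqmx_trans VW (eqmx_sym (eqmx_scale W k0)).
Qed.

Section Frame.

Variables (pi : plane R) (Sigma : circle pi) (e1 e2 e3 : 'rV[R]_3) (nu : R).
Hypotheses (e_ortho : orthonormal3 e1 e2 e3) (nu0 : nu != 0).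
Hypothesis normalE : normal pi = nu *: e3.

Let o := ccenter Sigma.
Let rho := cradius Sigma.
Let e33 : dot e3 e3 = 1.
Proof. by case: e_ortho => [[]]. Qed.

Lemma planeC_finite_point x : dot e3 (x - o) = 0 -> planeC pi (finite_point x).
Proof.
move=> x0; apply/planeCP; split.
  apply/eqP; rewrite /finite_point -row_mx0 => /eq_row_mx[_ /matrixP/(_ 0 0)/eqP].
  by rewrite !mxE eqxx oner_eq0.
rewrite /plane_form /hpart /hweight /finite_point row_mxKl row_mxKr mxE eqxx.
rewrite mulr1 dot_toC -(ccenter_in_plane Sigma) -rmorphB normalE !dotZl -mulrBr.
by rewrite -dotBr x0 mulr0 rmorph0.
Qed.

Lemma planeC_point_at_infinity u : u != 0 -> dot e3 u = 0 ->
  planeC pi (point_at_infinity u).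
Proof.
move=> u0 u3; apply/planeCP; split.
  apply: contraNneq u0; rewrite /point_at_infinity -row_mx0 => /eq_row_mx[h _].
  apply/eqP/rowP => i; have /rowP/(_ i) := h; rewrite !mxE => /eqP.
  by rewrite fmorph_eq0 => /eqP.
rewrite /plane_form /hpart /hweight /point_at_infinity row_mxKl row_mxKr mxE.
by rewrite mulr0 subr0 dot_toC normalE dotZl u3 mulr0 rmorph0.
Qed.

(** A homothety of ratio [k] gives [d = k c] or [d = - k c]; the former puts the centre on the
    plane. Likewise a translation gives [d = c], with direction parallel to the plane, or
    [d = - c]. *)
Lemma similitude_centre_weighted s t V x y c d :
  similitude_centre s t V -> ~ planeC pi V -> center s != center t ->
  center s = x + c *: e3 -> c ^+ 2 = radius s ^+ 2 -> dot e3 (x - o) = 0 ->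
  center t = y + d *: e3 -> d ^+ 2 = radius t ^+ 2 -> dot e3 (y - o) = 0 ->
  (V == weighted_centre s t c d)%MS.
Proof.
move=> Vst Vpi st sE c2 x0 tE d2 y0.
have cE : dot e3 (center s - o) = c.
  by rewrite sE addrAC dotDr x0 add0r dotZr e33 mulr1.
have dE : dot e3 (center t - o) = d.
  by rewrite tE addrAC dotDr y0 add0r dotZr e33 mulr1.
have c0 : c != 0 by rewrite -sqrf_eq0 c2 sqrf_eq0 gt_eqF ?radius_gt0.
case: Vst => [[p [k [Vp k0 /homothety_sphere]]] | [u [Vu u0 /translation_sphere]]].
  move=> /(_ k0)[tc tr].
  have k1 : k != 1.
    apply: contra_neq st => k1; rewrite tc k1 scale1r addrC subrK //.
  have h0 : dot e3 (p - o) != 0.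
    by apply/eqP => /planeC_finite_point/(planeC_same_point Vp).
  have dkc : d = (1 - k) * dot e3 (p - o) + k * c.
    by rewrite -dE -cE tc !(dotBr, dotDr, dotZr); ring.
  have : (d - k * c) * (d + k * c) = 0.
    transitivity (d ^+ 2 - k ^+ 2 * c ^+ 2); first by ring.
    by rewrite d2 c2 tr exprMn real_normK ?num_real // subrr.
  move/eqP; rewrite mulf_eq0 {1}dkc addrK mulf_eq0 (negPf h0) orbF.
  rewrite subr_eq0 eq_sym (negPf k1) /= addr_eq0 => /eqP {}dkc.
  (* Since [d = - k c], this factor is the weight [c + d]. *)
  apply: (eqmx_same_point (k := (c * (1 - k))%:C) Vp).
    by rewrite fmorph_eq0 mulf_neq0 // subr_eq0 eq_sym.
  rewrite /weighted_centre /finite_point scale_row_mx scale_scalar_mx mulr1.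
  rewrite dkc tc; congr row_mx; last by congr (_%:C%:M); ring.
  by apply/rowP => j; rewrite !mxE -rmorphM; congr (_%:C); ring.
move=> [tc tr]; have u3 : dot e3 u != 0.
  by apply/eqP => /(planeC_point_at_infinity u0)/(planeC_same_point Vu).
have dcu : d = c + dot e3 u.
  by rewrite -dE -cE tc addrAC dotDr.
have : (d - c) * (d + c) = 0.
  transitivity (d ^+ 2 - c ^+ 2); first by ring.
  by rewrite d2 c2 tr subrr.
move/eqP; rewrite mulf_eq0 {1}dcu addrAC subrr add0r (negPf u3) /= addr_eq0.
move=> /eqP dc; apply: (eqmx_same_point (k := c%:C) Vu); first by rewrite fmorph_eq0.
rewrite /weighted_centre /point_at_infinity scale_row_mx dc tc subrr rmorph0.
rewrite scaler0; congr row_mx.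
by apply/rowP => j; rewrite !mxE -rmorphM; congr (_%:C); ring.
Qed.

Lemma weighted_centre_hpoint s t (a1 a2 c b1 b2 d : R) :
  center s = o + (a1 *: e1 + a2 *: e2) + c *: e3 ->
  center t = o + (b1 *: e1 + b2 *: e2) + d *: e3 ->
  weighted_centre s t c d = hpoint Sigma e1 e2 e3
    (c%:C * (b1%:C + 'i * b2%:C) + d%:C * (a1%:C + 'i * a2%:C))
    (c%:C * (b1%:C - 'i * b2%:C) + d%:C * (a1%:C - 'i * a2%:C))
    (2 * c%:C * d%:C) (c%:C + d%:C).
Proof.
move=> sE tE; rewrite /weighted_centre rmorphD.
have -> : toC (c *: center t + d *: center s) =
    c%:C *: toC (center t) + d%:C *: toC (center s).
  by apply/rowP => j; rewrite !mxE rmorphD !rmorphM.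
have <- : c%:C * d%:C + d%:C * c%:C = 2 * c%:C * d%:C.
  by rewrite [d%:C * _]mulrC -mulr2n -mulrA mulr_natl.
by rewrite sE tE !toC_frame_vec frame_vec_lin !mulr1.
Qed.

(** Here [m] and [n] are the heights of the poles over the plane. After division by the radius of
    the circle, the three relations on [a1], [b1], [m], [n] amount to the hypothesis [kE] of
    [poncelet_triangle]. *)
Lemma poncelet_of_coordinates s t V (a1 a2 c b1 b2 d m n : R) :
  center s = o + (a1 *: e1 + a2 *: e2) + c *: e3 -> c ^+ 2 = radius s ^+ 2 ->
  center t = o + (b1 *: e1 + b2 *: e2) + d *: e3 -> d != 0 ->
  a1 ^+ 2 + a2 ^+ 2 = rho ^+ 2 + 2 * c * m ->
  b1 ^+ 2 + b2 ^+ 2 = rho ^+ 2 + 2 * d * n ->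
  m * n = - rho ^+ 2 ->
  (V == weighted_centre s t c d)%MS ->
  poncelet_3pair (circleC Sigma) (circumscribed_cone s V `&` planeC pi).
Proof.
move=> sE c2 tE d0 aE bE mn /circumscribed_cone_eqmx ->.
have c0 : c != 0 by rewrite -sqrf_eq0 c2 sqrf_eq0 gt_eqF ?radius_gt0.
have rho0 : rho != 0 by rewrite gt_eqF ?cradius_gt0.
have rhoC : rho%:C != 0 :> R[i] by rewrite fmorph_eq0.
rewrite (weighted_centre_hpoint sE tE).
set V' := hpoint _ _ _ _ _ _ _ _.
have V'pi : plane_form pi V' != 0.
  by rewrite (plane_form_hpoint _ e_ortho normalE) !mulf_neq0 ?fmorph_eq0 ?pnatr_eq0.
have i2 (x y : R) :
    (x%:C + 'i * y%:C) * (x%:C - 'i * y%:C) = (x ^+ 2 + y ^+ 2)%:C :> R[i].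
  by rewrite mulrC -subr_sqr exprMn sqrCi mulN1r opprK -!rmorphXn -rmorphD.
pose a := (a1%:C + 'i * a2%:C) / rho%:C; pose a' := (a1%:C - 'i * a2%:C) / rho%:C.
pose b := (b1%:C + 'i * b2%:C) / rho%:C; pose b' := (b1%:C - 'i * b2%:C) / rho%:C.
have aa' : a * a' - 1 = (2 * c * m / rho ^+ 2)%:C.
  rewrite mulrACA i2 aE -invfM -rmorphM -fmorphV -rmorphM.
  rewrite -(rmorph1 (real_complex R)) -rmorphB.
  by congr (_%:C); field.
have bb' : b * b' - 1 = (2 * d * n / rho ^+ 2)%:C.
  rewrite mulrACA i2 bE -invfM -rmorphM -fmorphV -rmorphM.
  rewrite -(rmorph1 (real_complex R)) -rmorphB.
  by congr (_%:C); field.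
have mn0 : m * n != 0 by rewrite mn oppr_eq0 sqrf_eq0.
have [m0 n0] : m != 0 /\ n != 0 by move: mn0; rewrite mulf_eq0 negb_or => /andP.
pose k := c%:C * d%:C / rho%:C ^+ 2.
have kE : 4 * k = - ((a * a' - 1) * (b * b' - 1)).
  rewrite aa' bb' /k -rmorphM -rmorphXn -fmorphV -rmorphM -rmorphM -rmorphN.
  rewrite -[4](rmorph_nat (real_complex R)) -rmorphM; congr (_%:C).
  have -> : - (2 * c * m / rho ^+ 2 * (2 * d * n / rho ^+ 2)) =
    - (4 * c * d * (m * n)) / rho ^+ 4 by field.
  by rewrite mn; field.
have aa'1 : a * a' != 1.
  by rewrite -subr_eq0 aa' fmorph_eq0 !mulf_neq0 ?invr_neq0 ?pnatr_eq0 ?sqrf_eq0.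
have bb'1 : b * b' != 1.
  by rewrite -subr_eq0 bb' fmorph_eq0 !mulf_neq0 ?invr_neq0 ?pnatr_eq0 ?sqrf_eq0.
have [t1 [t2 [t3 [[t12 t23 t31] T12 T23 T31]]]] 
    := poncelet_triangle aa'1 bb'1 kE.
pose P := circle_point Sigma e1 e2 e3.
have scl z : rho%:C * (z / rho%:C) = z by rewrite mulrC divfK.
(* At points of the circle the cone's form is a nonzero constant times [conic_form], so tangent
   chords give tangent lines. *)
have QE x y : cone_form s V' (P x) (P y) =
    (rho%:C ^+ 2 * c%:C) ^+ 2 * conic_form a a' b b' k x y.
  rewrite -cone_form_conic_form //.
  rewrite /cone_form sE !(polar_form_hpoint Sigma e_ortho) -c2 rmorphXn.
  by rewrite /a /a' /b /b' !scl.
have q0 : (rho%:C ^+ 2 * c%:C) ^+ 2 != 0 :> R[i].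
  by rewrite sqrf_eq0 mulf_neq0 ?sqrf_eq0 ?fmorph_eq0.
move: (_ ^+ 2) q0 QE => K K0 QE.
have tangent x y : x != y -> tangent_chord a a' b b' k x y ->
    tangent_line_conic (circumscribed_cone s V' `&` planeC pi) (line (P x) (P y)).
  move=> xy [disc nz]; apply: tangent_line_cone_section => //.
  - exact: (planeC_circle_point Sigma e_ortho normalE).
  - exact: (planeC_circle_point Sigma e_ortho normalE).
  - exact: (circle_point_line Sigma e_ortho).
  - by rewrite !QE exprMn disc expr2; exact: mulrACA.
  - rewrite !QE => -[h1 h2 h3]; apply: nz.
    by split; apply: (mulfI K0); rewrite mulr0.
exists (P t1), (P t2), (P t3); split.
- exact: (circle_point_triangle Sigma e_ortho).
- by split; apply: (circleC_circle_point Sigma e_ortho normalE).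
- by split; apply: tangent.
Qed.

End Frame.
End SimilitudeCentre.

(** * Reduction of the spatial configuration to coordinates *)

Theorem mainTheorem3 (R : realType) (pi : plane R) (Sigma : circle pi)
    (gamma : sphere R)
    (Sigma_gamma : circle_set Sigma `<=` sphere_set gamma)
    (S1 S2 : 'rV[R]_3)
    (S1_pole : pole gamma pi S1) (S2_pole : pole gamma pi S2)
    (S1_neq_S2 : S1 != S2)
    (alpha beta : sphere R)
    (alpha_class : tangent_class gamma pi S1 alpha)
    (beta_class : tangent_class gamma pi S2 beta)
    (V : 'rV[complex R]_(3 + 1))
    (V_centre : similitude_centre alpha beta V)
    (V_notin_pi : ~ planeC pi V) :
  poncelet_3pair (circleC Sigma) (circumscribed_cone alpha V `&` planeC pi).
Proof.
have [e1 [e2 [e3 [nu [e_ortho nu0 normalE]]]]] := orthonormal_frame (normal_neq0 pi).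
have [h gammaE g2] := circle_on_sphere e_ortho nu0 normalE Sigma_gamma.
have pole_at S : pole gamma pi S ->
    exists2 m, S = center gamma + m *: e3 & m ^+ 2 = radius gamma ^+ 2.
  move=> [gS /(parallel_tangent_plane e_ortho nu0 normalE gS)[c cE c2]].
  by exists (- c); rewrite ?sqrrN // cE scaleNr addrK.
have [m S1E m2] := pole_at _ S1_pole; have [n S2E n2] := pole_at _ S2_pole.
(* Both poles lie at distance the radius from the centre of [gamma] on its axis; being distinct,
   they are opposite. *)
have nm : n = - m.
  have : (m - n) * (m + n) = 0 by rewrite -subr_sqr m2 n2 subrr.
  move/eqP; rewrite mulf_eq0 subr_eq0 addr_eq0 => /orP[/eqP mn|/eqP->].
    by move: S1_neq_S2; rewrite S1E S2E mn eqxx.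
  by rewrite opprK.
have [x [c [alphaE c2 x0 xx]]] :=
  tangent_class_frame e_ortho nu0 normalE gammaE g2 S1E m2 alpha_class.
have [y [d [betaE d2 y0 yy]]] :=
  tangent_class_frame e_ortho nu0 normalE gammaE g2 S2E n2 beta_class.
have flat z : dot e3 (z - ccenter Sigma) = 0 ->
    z = ccenter Sigma + (dot (z - ccenter Sigma) e1 *: e1
                         + dot (z - ccenter Sigma) e2 *: e2) /\
    dot (z - ccenter Sigma) (z - ccenter Sigma) =
    dot (z - ccenter Sigma) e1 ^+ 2 + dot (z - ccenter Sigma) e2 ^+ 2.
  have := orthonormal_expansion (z - ccenter Sigma) e_ortho.
  case: e_ortho => [[e11 e22 e33] [e12 e13 e23]].
  rewrite [dot _ e3]dotC => zE z0; rewrite z0 scale0r addr0 in zE.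
  split; first by rewrite -zE addrC subrK.
  by rewrite {2}zE dotDr !dotZr -!expr2.
have [xE xn] := flat _ x0; have [yE yn] := flat _ y0.
have d0 : d != 0 by rewrite -sqrf_eq0 d2 sqrf_eq0 gt_eqF ?radius_gt0.
have m0 : m != 0 by rewrite -sqrf_eq0 m2 sqrf_eq0 gt_eqF ?radius_gt0.
have c0 : c != 0 by rewrite -sqrf_eq0 c2 sqrf_eq0 gt_eqF ?radius_gt0.
have e33 : dot e3 e3 = 1 by case: e_ortho => [[]].
(* A common centre would give equal heights and contact points, and the two class relations would
   then yield [4 c m = 0]. *)
have alpha_beta : center alpha != center beta.
  apply/eqP => ab.
  have height z k s : center s = z + k *: e3 -> dot e3 (z - ccenter Sigma) = 0 ->
      dot e3 (center s - ccenter Sigma) = k.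
    by move=> -> z0; rewrite addrAC dotDr z0 add0r dotZr e33 mulr1.
  have cd : c = d.
    by rewrite -(height _ _ _ alphaE x0) -(height _ _ _ betaE y0) ab.
  have xy : x = y by move: ab; rewrite alphaE betaE cd => /addIr.
  have : 4 * c * m = 0.
    transitivity ((cradius Sigma ^+ 2 + 2 * c * (h + m))
      - (cradius Sigma ^+ 2 + 2 * d * (h + n))); first by rewrite cd nm; ring.
    by rewrite -xx -yy xy subrr.
  by apply/eqP; rewrite !mulf_neq0 ?pnatr_eq0.
have aE : center alpha = ccenter Sigma + (dot (x - ccenter Sigma) e1 *: e1
    + dot (x - ccenter Sigma) e2 *: e2) + c *: e3 by rewrite -xE.
have bE : center beta = ccenter Sigma + (dot (y - ccenter Sigma) e1 *: e1
    + dot (y - ccenter Sigma) e2 *: e2) + d *: e3 by rewrite -yE.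
rewrite xn in xx; rewrite yn in yy.
(* The product of the pole heights is the power, with respect to [gamma], of the centre of the
   circle. *)
have mn : (h + m) * (h + n) = - cradius Sigma ^+ 2.
  by rewrite nm mulrC -subr_sqr m2 g2; ring.
apply: (poncelet_of_coordinates e_ortho nu0 normalE aE c2 bE d0 xx yy mn).
exact: (similitude_centre_weighted e_ortho normalE V_centre V_notin_pi alpha_beta
  alphaE c2 x0 betaE d2 y0).
Qed.
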